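(* Let $\mathcal{P}=\mathcal{T}(V)/(R)$ be a binary operad. (a) There is a morphism of operads $\mathrm{Du}(\mathcal{P})\to \mathrm{DA}(\mathcal{P})$ from the duplicator of $\mathcal{P}$ to the operad of di-average $\mathcal{P}$-algebras, which extends the map $$\xi:\ \binom{\omega}{\dashv}\mapsto \omega\circ(\mathrm{id}\otimes P),\qquad \binom{\omega}{\vdash}\mapsto\omega\circ(P\otimes\mathrm{id}),\qquad \omega\in V.$$ (b) Let $A$ be a $\mathcal{P}$-algebra and let $P:A\to A$ be a di-average operator. Then the operations $$x\dashv_j y:=x\circ_j P(y),\qquad x\vdash_j y:=P(x)\circ_j y,\qquad x,y\in A,\ \circ_j\in\mathcal{P}(2),$$ make $A$ into a $\mathrm{Du}(\mathcal{P})$-algebra.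
   Context: Operads and trees. $\mathcal{P}=\mathcal{T}(V)/(R)$ over a field $\mathbf{k}$, where $V=V(2)$ is an $\mathbb{S}_2$-module, $\mathcal{T}(V)$ is the free symmetric operad on $V$, and $(R)$ is the operadic ideal generated by $R$. Fix a linear basis $\mathcal{V}$ of $V$ and one planar representative for each isomorphism class of reduced binary rooted trees, so that $\mathcal{T}(V)$ has a basis of decorated planar trees (vertices decorated by elements of $\mathcal{V}$, leaves by distinct positive integers). $R$ is a set of locally homogeneous elements: each $r\in R$ is a combination $r=\sum_i c_i\tau_i$ of such decorated trees with the same set $\mathrm{Lin}(r)$ of leaf labels. The construction of the duplicator below is regarded as independent of these choices. Duplicator. $\mathrm{Du}(V)=V\otimes(\mathbf{k}\dashv\oplus\,\mathbf{k}\vdash)$; write $\binom{\omega}{u}=\omega\otimes u$, with $\binom{\omega}{\dashv}^{(12)}=\binom{\omega^{(12)}}{\vdash}$, $\binom{\omega}{\vdash}^{(12)}=\binom{\omega^{(12)}}{\dashv}$. For a leaf $x$ of a decorated tree $\tau$, $\mathrm{Du}_x(\tau)$ is the set of all trees obtained by replacing each vertex decoration $\omega$ by $\binom{\omega}{\dashv}$ (resp. $\binom{\omega}{\vdash}$) if the path from the root to $x$ turns left (resp. right) there, and by either of the two (all independent choices) if the path does not pass there. For $r=\sum_i c_i\tau_i$, $\mathrm{Du}_x(r)=\{\sum_i c_iw_i\mid w_i\in\mathrm{Du}_x(\tau_i)\}$, and $\mathrm{Du}(\mathcal{P})=\mathcal{T}(\mathrm{Du}(V))/(\bigcup_{r\in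 R}\bigcup_{x\in\mathrm{Lin}(r)}\mathrm{Du}_x(r))$. Average operators. A di-average operator on a $\mathbf{k}$-module $A$ with a binary operation $\cdot$ is a $\mathbf{k}$-linear map $P:A\to A$ with $P(x\cdot P(y))=P(x)\cdot P(y)=P(P(x)\cdot y)$ for all $x,y\in A$; on a $\mathcal{P}$-algebra these identities are required for every operation in $V$. Let $V_P$ be the $\mathbb{S}$-module with $V_P(1)=\mathbf{k}P$ ($P$ a symbol, a unary operation different from $\mathrm{id}$) and $V_P(2)=V$, and let $\mathcal{T}(V_P)$ be the free operad on it. Put $$\mathrm{DA}_{\mathcal{P}}=\{\omega\circ(P\otimes P)-P\circ\omega\circ(P\otimes\mathrm{id}),\ \omega\circ(P\otimes P)-P\circ\omega\circ(\mathrm{id}\otimes P)\mid\omega\in V\}.$$ The operad of di-average $\mathcal{P}$-algebras is $\mathrm{DA}(\mathcal{P})=\mathcal{T}(V_P)/(R,\mathrm{DA}_{\mathcal{P}})$. *)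

(* Defs.v *)
From HB Require Import structures.
From Stdlib Require List.
From mathcomp Require Import all_boot all_order all_algebra all_fingroup.
From mathcomp Require Import zify.
From mathcomp Require Import boolp classical_sets functions.

Set Implicit Arguments.
Unset Strict Implicit.
Unset Printing Implicit Defensive.

Import GRing.Theory.
Local Open Scope ring_scope.
Local Open Scope quotient_scope.
Local Obligation Tactic := idtac.

Record sgmod (k : fieldType) (n : nat) := SgMod {
  sg_car :> lmodType k;
  sg_act : sg_car -> 'S_n -> sg_car;
  sg_act_linear : forall s, linear (sg_act^~ s);
  sg_act1 : forall u, sg_act u 1%g = u;
  sg_actM : forall u s t, sg_act u (s * t)%g = sg_act (sg_act u s) t }.

Record smod_mor (k : fieldType) (M N : forall n, sgmod k n) := SmodMor {
  smor_fun :> forall n, {linear M n -> N n};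
  smor_act : forall n (u : M n) s,
    smor_fun n (sg_act u s) = sg_act (smor_fun n u) s }.

(** Inputs are numbered from 0.  In the partial composite of [a], of arity
    [m], with [b], of arity [n], at the input [i] of [a], the input [j] of [b]
    becomes the input [i + j], and the input [i' != i] of [a] becomes the
    input [lpos n i i'].  Partial composition takes as argument a proof that
    the arity [p] of the result is [m + n - 1], so that no transport between
    different arities is needed in the axioms.

    In mathcomp [(s * t) x = t (s x)], so the right action [sg_act a s] is to
    be read as: the input [i] of [a] is renamed [s i]. *)

Definition lpos (n i i' : nat) : nat :=
  if (i' < i)%N then i' else (i' + n).-1.

(** [r] is the permutation by which [s] and [t] act on the inputs of a partial
    composite at [i] with a second operation of arity [n]. *)
Definition comp_perm (m n p : nat) (i : 'I_m) (s : 'S_m) (t : 'S_n) (r : 'S_p)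
  : Prop :=
  (forall (i' : 'I_m) (q : 'I_p), i' != i ->
     q = lpos n i i' :> nat -> r q = lpos n (s i) (s i') :> nat) /\
  (forall (j : 'I_n) (q : 'I_p),
     q = (i + j)%N :> nat -> r q = (s i + t j)%N :> nat).

Record operad (k : fieldType) := Operad {
  op_car :> forall n, sgmod k n;
  op_id : op_car 1%N;
  op_comp : forall m n p, (m + n = p.+1)%N -> 'I_m ->
    op_car m -> op_car n -> op_car p;
  op_comp_linearl : forall m n p (e : (m + n = p.+1)%N) (i : 'I_m)
      (b : op_car n),
    linear (fun a => op_comp e i a b);
  op_comp_linearr : forall m n p (e : (m + n = p.+1)%N) (i : 'I_m)
      (a : op_car m),
    linear (fun b => op_comp e i a b);
  op_comp1l : forall n (e : (1 + n = n.+1)%N) (i : 'I_1) (a : op_car n),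
    op_comp e i op_id a = a;
  op_comp1r : forall n (e : (n + 1 = n.+1)%N) (i : 'I_n) (a : op_car n),
    op_comp e i a op_id = a;
  op_compA : forall l m n p q r
      (e1 : (l + m = p.+1)%N) (e2 : (p + n = r.+1)%N)
      (e3 : (m + n = q.+1)%N) (e4 : (l + q = r.+1)%N)
      (i : 'I_l) (j : 'I_m) (h : 'I_p)
      (a : op_car l) (b : op_car m) (c : op_car n),
    h = (i + j)%N :> nat ->
    op_comp e2 h (op_comp e1 i a b) c = op_comp e4 i a (op_comp e3 j b c);
  op_compAC : forall l m n p q r
      (e1 : (l + m = p.+1)%N) (e2 : (p + n = r.+1)%N)
      (e3 : (l + n = q.+1)%N) (e4 : (q + m = r.+1)%N)
      (i j : 'I_l) (h : 'I_p) (h' : 'I_q)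
      (a : op_car l) (b : op_car m) (c : op_car n),
    (i < j)%N -> h = lpos m i j :> nat -> h' = i :> nat ->
    op_comp e2 h (op_comp e1 i a b) c = op_comp e4 h' (op_comp e3 j a c) b;
  op_comp_act : forall m n p (e : (m + n = p.+1)%N) (i : 'I_m)
      (s : 'S_m) (t : 'S_n) (r : 'S_p) (a : op_car m) (b : op_car n),
    comp_perm i s t r ->
    op_comp e (s i) (sg_act a s) (sg_act b t) = sg_act (op_comp e i a b) r }.

Record operad_mor (k : fieldType) (O O' : operad k) := OperadMor {
  omor_smod :> smod_mor O O';
  omor_id : omor_smod 1%N (op_id O) = op_id O';
  omor_comp : forall m n p (e : (m + n = p.+1)%N) (i : 'I_m)
      (a : O m) (b : O n),
    omor_smod p (op_comp e i a b) =
    op_comp e i (omor_smod m a) (omor_smod n b) }.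

Section Endomorphisms.
Variables (k : fieldType) (A : lmodType k).

Definition upd n (x : 'I_n -> A) (i : 'I_n) (u : A) : 'I_n -> A :=
  fun j => if j == i then u else x j.

Definition multilinear n (f : ('I_n -> A) -> A) : Prop :=
  forall x i, linear (fun u => f (upd x i u)).

Definition multilinear_pred n : pred (('I_n -> A) -> A) :=
  fun f => `[< multilinear f >].

Lemma multilinear_submod n : submod_closed (@multilinear_pred n).
Proof.
split.
  by apply/asboolP => x i c u v; rewrite -[LHS]/(0 : A) scaler0 addr0.
move=> c f g /asboolP fl /asboolP gl; apply/asboolP => x i d u v.
have E w : (c *: f + g) w = c *: f w + g w by [].
by rewrite !E fl gl !scalerDr !scalerA [c * d]mulrC addrACA.
Qed.

HB.instance Definition _ n :=
  GRing.isSubmodClosed.Build k (('I_n -> A) -> A) (@multilinear_pred n)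
    (@multilinear_submod n).

Record mlin n := Mlin {
  mlin_fun :> ('I_n -> A) -> A;
  mlin_funP : mlin_fun \in @multilinear_pred n }.

HB.instance Definition _ n := [isSub for @mlin_fun n].
HB.instance Definition _ n := [Choice of mlin n by <:].
HB.instance Definition _ n := [SubChoice_isSubLmodule of mlin n by <:].

Lemma mlinP n (f : mlin n) : multilinear f.
Proof. exact/asboolP/mlin_funP. Qed.

Definition mk_mlin n f (H : multilinear f) : mlin n :=
  Mlin (introT (asboolP (multilinear f)) H).

Lemma mlin_eq n (f g : mlin n) : (forall x, f x = g x) -> f = g.
Proof. by move=> fg; apply/val_inj/funext. Qed.

Lemma end_act_multilinear n (f : mlin n) (s : 'S_n) :
  multilinear (fun x => f (x \o s)).
Proof.
move=> x i c u v; have E w : upd x i w \o s = upd (x \o s) (s^-1%g i) w.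
  apply/funext => j; rewrite /upd /=.
  by rewrite -[in RHS](inj_eq (@perm_inj _ s)) permKV.
by rewrite !E mlinP.
Qed.

Definition end_act n (f : mlin n) (s : 'S_n) : mlin n :=
  mk_mlin (end_act_multilinear f s).

Definition arg n (x : 'I_n -> A) (q : nat) : A := oapp x 0 (insub q).

Lemma argE n (x : 'I_n -> A) (q : 'I_n) : arg x q = x q.
Proof. by rewrite /arg insubT // => lt_q; congr x; apply: val_inj. Qed.

Lemma arg_upd n (x : 'I_n -> A) (i : 'I_n) u q :
  arg (upd x i u) q = if q == i then u else arg x q.
Proof.
rewrite /arg; case: insubP => /= [q' _ <-|Nq]; first by rewrite /upd -val_eqE.
by case: eqP => // E; rewrite E ltn_ord in Nq.
Qed.

Definition end_comp_fun m n p (i : 'I_m) (f : ('I_m -> A) -> A)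
    (g : ('I_n -> A) -> A) (x : 'I_p -> A) : A :=
  f (fun i' : 'I_m => if i' == i then g (fun j : 'I_n => arg x (i + j))
                      else arg x (lpos n i i')).

Lemma slotP m n p (e : (m + n = p.+1)%N) (i : 'I_m) (q : 'I_p) :
  (exists j : 'I_n, q = (i + j)%N :> nat) \/
  (exists2 i' : 'I_m, i' != i & q = lpos n i i' :> nat).
Proof.
have := ltn_ord q; have := ltn_ord i => im qp.
case: (ltnP q i) => [qi|iq].
  right; have qm : (q < m)%N by lia.
  exists (Ordinal qm); first by rewrite -val_eqE /=; lia.
  by rewrite /lpos /= qi.
case: (ltnP q (i + n)) => [qin|inq].
  by left; have jn : (q - i < n)%N by [lia]; exists (Ordinal jn) => /=; lia.
right; have qm : (q.+1 - n < m)%N by lia.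
exists (Ordinal qm); first by rewrite -val_eqE /=; lia.
by rewrite /lpos /=; case: ltnP; lia.
Qed.

Lemma lpos_slot m n (i i' : 'I_m) (j : 'I_n) :
  i' != i -> (lpos n i i' == (i + j)%N) = false.
Proof.
rewrite -val_eqE /= => ne; have := ltn_ord j; rewrite /lpos.
by case: (ltnP i' i) => ? ?; apply/negbTE/eqP; lia.
Qed.

Lemma lpos_inj m n (i i' i'' : 'I_m) :
  i' != i -> i'' != i -> (lpos n i i'' == lpos n i i') = (i'' == i').
Proof.
rewrite -!val_eqE /= /lpos => h1 h2.
by case: (ltnP i'' i) => ?; case: (ltnP i' i) => ?; lia.
Qed.

Lemma lpos_lt m n p (e : (m + n = p.+1)%N) (i i' : 'I_m) :
  i' != i -> (lpos n i i' < p)%N.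
Proof.
rewrite -val_eqE /= /lpos => h; have := ltn_ord i; have := ltn_ord i'.
by case: (ltnP i' i); lia.
Qed.

Lemma end_comp_multilinear m n p (e : (m + n = p.+1)%N) (i : 'I_m)
    (f : mlin m) (g : mlin n) : multilinear (@end_comp_fun m n p i f g).
Proof.
move=> x q c u v; rewrite /end_comp_fun.
set F := fun (y : 'I_p -> A) (i' : 'I_m) =>
  if i' == i then g (fun j : 'I_n => arg y (i + j)) else arg y (lpos n i i').
rewrite -/(F (upd x q (c *: u + v))) -/(F (upd x q u)) -/(F (upd x q v)).
case: (slotP e i q) => [[j qE]|[i' ne qE]].
  have E w : F (upd x q w) =
      upd (F x) i (g (upd (fun j' : 'I_n => arg x (i + j')) j w)).
    apply/funext => i'; rewrite /F /upd; case: (i' =P i) => [_|/eqP ne].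
      congr (g _); apply/funext => j'.
      by rewrite -/(upd x q w) arg_upd qE eqn_add2l.
    by rewrite -/(upd x q w) arg_upd qE lpos_slot.
  by rewrite !E mlinP mlinP.
have E w : F (upd x q w) = upd (F x) i' w.
  apply/funext => i''; rewrite /F.
  have -> : upd (F x) i' w i'' = if i'' == i' then w else F x i'' by [].
  rewrite /F; case: (i'' =P i) => [->|/eqP ne'].
    rewrite eq_sym (negbTE ne); congr (g _); apply/funext => j.
    by rewrite arg_upd qE eq_sym lpos_slot.
  by rewrite arg_upd qE lpos_inj.
by rewrite !E mlinP.
Qed.

Definition end_comp m n p (e : (m + n = p.+1)%N) (i : 'I_m)
    (f : mlin m) (g : mlin n) : mlin p :=
  mk_mlin (end_comp_multilinear e i f g).

Lemma end_id_multilinear : multilinear (fun x : 'I_1 -> A => x ord0).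
Proof. by move=> x i c u v; rewrite /upd !ord1 eqxx. Qed.

Definition end_id : mlin 1 := mk_mlin end_id_multilinear.

Lemma end_act_linear n s : linear (@end_act n ^~ s).
Proof. by move=> c f g; apply: mlin_eq. Qed.

Lemma end_act1 n f : @end_act n f 1%g = f.
Proof.
by apply: mlin_eq => x /=; congr (f _); apply/funext => i /=; rewrite perm1.
Qed.

Lemma end_actM n f s t : @end_act n f (s * t)%g = end_act (end_act f s) t.
Proof.
by apply: mlin_eq => x /=; congr (f _); apply/funext => i /=; rewrite permM.
Qed.

Definition end_sgmod n : sgmod k n :=
  SgMod (@end_act_linear n) (@end_act1 n) (@end_actM n).

Lemma end_comp_linearl m n p (e : (m + n = p.+1)%N) (i : 'I_m) g :
  linear (fun f => @end_comp m n p e i f g).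
Proof. by move=> c f f'; apply: mlin_eq. Qed.

Lemma end_comp_linearr m n p (e : (m + n = p.+1)%N) (i : 'I_m) f :
  linear (fun g => @end_comp m n p e i f g).
Proof.
move=> c g g'; apply: mlin_eq => x /=.
rewrite /end_comp_fun /=.
set X := fun j : 'I_n => arg x (i + j).
set Y := fun i' : 'I_m => arg x (lpos n i i').
have E w : (fun i' : 'I_m => if i' == i then w else Y i') = upd Y i w by [].
by rewrite !E mlinP.
Qed.

Lemma end_comp1l n (e : (1 + n = n.+1)%N) (i : 'I_1) f :
  end_comp e i end_id f = f.
Proof.
apply: mlin_eq => x /=; rewrite /end_comp_fun (ord1 i) /=; congr (f _).
by apply/funext => j; rewrite argE.
Qed.

Lemma end_comp1r n (e : (n + 1 = n.+1)%N) (i : 'I_n) f :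
  end_comp e i f end_id = f.
Proof.
apply: mlin_eq => x /=; rewrite /end_comp_fun /=; congr (f _).
apply/funext => j; case: eqP => [->|_]; first by rewrite addn0 argE.
by rewrite /lpos addn1 /= if_same argE.
Qed.

Lemma argF n (q : nat) (G : nat -> A) : (q < n)%N ->
  arg (fun i : 'I_n => G i) q = G q.
Proof. by move=> qn; rewrite -[q in LHS]/(val (Ordinal qn)) argE. Qed.

Lemma end_compA l m n p q r
    (e1 : (l + m = p.+1)%N) (e2 : (p + n = r.+1)%N)
    (e3 : (m + n = q.+1)%N) (e4 : (l + q = r.+1)%N)
    (i : 'I_l) (j : 'I_m) (h : 'I_p) a b c :
  h = (i + j)%N :> nat ->
  end_comp e2 h (end_comp e1 i a b) c = end_comp e4 i a (end_comp e3 j b c).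
Proof.
move=> hE; apply: mlin_eq => x /=; rewrite /end_comp_fun /=.
pose G (s : nat) := if s == h then c (fun j0 : 'I_n => arg x (h + j0))
                    else arg x (lpos n h s).
have -> : (fun i' : 'I_p => if i' == h then c (fun j0 : 'I_n => arg x (h + j0))
      else arg x (lpos n h i')) = (fun i' : 'I_p => G i') by [].
congr (a _); apply/funext => i'; case: eqP => [_|/eqP ne].
  congr (b _); apply/funext => j'; rewrite (argF G); last first.
    by have := ltn_ord i; have := ltn_ord j'; lia.
  have -> : G (i + j')%N = if j' == j then c (fun j0 : 'I_n => arg x (h + j0))
      else arg x (lpos n h (i + j')) by rewrite /G hE eqn_add2l val_eqE.
  rewrite hE; case: (j' =P j) => [_|/eqP ne].
    congr (c _); apply/funext => j0.
    rewrite (argF (fun s => arg x (i + s))); first by rewrite addnA.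
    by have := ltn_ord j; have := ltn_ord j0; lia.
  rewrite (argF (fun s => arg x (i + s))).
    have nev := ne; rewrite -val_eqE /= in nev.
    by rewrite /lpos ltn_add2l; case: ltnP => // ?; congr (arg x); lia.
  exact: (lpos_lt e3).
rewrite (argF G); last exact: lpos_lt ne.
rewrite /G hE lpos_slot //; congr (arg x); rewrite /lpos.
have := ltn_ord j; move: ne; rewrite -val_eqE /= => ne jm.
by case: (ltnP i' i) => ?; case: ltnP; lia.
Qed.

Lemma end_compAC l m n p q r
    (e1 : (l + m = p.+1)%N) (e2 : (p + n = r.+1)%N)
    (e3 : (l + n = q.+1)%N) (e4 : (q + m = r.+1)%N)
    (i j : 'I_l) (h : 'I_p) (h' : 'I_q) a b c :
  (i < j)%N -> h = lpos m i j :> nat -> h' = i :> nat ->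
  end_comp e2 h (end_comp e1 i a b) c = end_comp e4 h' (end_comp e3 j a c) b.
Proof.
move=> ij hE h'E; apply: mlin_eq => x /=; rewrite /end_comp_fun /=.
pose G (s : nat) := if s == h then c (fun j0 : 'I_n => arg x (h + j0))
                    else arg x (lpos n h s).
have -> : (fun i' : 'I_p => if i' == h then c (fun j0 : 'I_n => arg x (h + j0))
      else arg x (lpos n h i')) = (fun i' : 'I_p => G i') by [].
pose G' (s : nat) := if s == h' then b (fun j0 : 'I_m => arg x (h' + j0))
                    else arg x (lpos m h' s).
have -> : (fun i' : 'I_q => if i' == h' then b (fun j0 => arg x (h' + j0))
      else arg x (lpos m h' i')) = (fun i' : 'I_q => G' i') by [].
have hE' : h = (j + m).-1 :> nat by rewrite hE /lpos; case: ltnP; lia.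
have := ltn_ord j => jl.
congr (a _); apply/funext => i'; case: (i' =P i) => [->|/eqP ne].
  have -> : (i == j) = false by rewrite -val_eqE /=; lia.
  rewrite (argF G'); last by rewrite /lpos ij; lia.
  rewrite /G' {1}/lpos ij h'E eqxx; congr (b _); apply/funext => j'.
  have := ltn_ord j' => ?.
  rewrite (argF G); last by lia.
  rewrite /G; have -> : (i + j' == h)%N = false by rewrite hE'; lia.
  by rewrite /lpos hE'; case: ltnP => //; lia.
rewrite (argF G); last exact: lpos_lt ne.
case: (i' =P j) => [->|/eqP ne'].
  rewrite /G -hE eqxx; congr (c _); apply/funext => j'.
  have := ltn_ord j' => ?.
  rewrite (argF G'); last by lia.
  rewrite /G' h'E; have -> : (j + j' == i)%N = false by lia.
  by rewrite /lpos; case: ltnP => ?; congr (arg x); lia.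
rewrite (argF G'); last exact: lpos_lt ne'.
move: ne ne'; rewrite -!val_eqE /= => ne ne'.
have -> : G (lpos m i i') = arg x (lpos n h (lpos m i i')).
  rewrite /G ifN // hE' /lpos; case: (ltnP i' i) => ?; lia.
have -> : G' (lpos n j i') = arg x (lpos m h' (lpos n j i')).
  rewrite /G' ifN // h'E /lpos; case: (ltnP i' j) => ?; lia.
congr (arg x); rewrite /lpos hE' h'E.
by case: (ltnP i' i) => ?; case: (ltnP i' j) => ?; case: ltnP => ?;
  case: ltnP => ?; lia.
Qed.

Lemma end_comp_act m n p (e : (m + n = p.+1)%N) (i : 'I_m)
    (s : 'S_m) (t : 'S_n) (r : 'S_p) a b :
  comp_perm i s t r ->
  end_comp e (s i) (end_act a s) (end_act b t) = end_act (end_comp e i a b) r.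
Proof.
case=> r1 r2; apply: mlin_eq => x /=; rewrite /end_comp_fun /=.
congr (a _); apply/funext => i' /=.
rewrite (inj_eq (@perm_inj _ s)); case: eqP => [_|/eqP ne].
  congr (b _); apply/funext => j /=.
  have lt_ij : (i + j < p)%N by have := ltn_ord i; have := ltn_ord j; lia.
  rewrite -[RHS]/(arg (x \o r) (Ordinal lt_ij)) argE /=.
  by rewrite -argE (r2 j).
rewrite -[RHS]/(arg (x \o r) (Ordinal (lpos_lt e ne))) argE /=.
by rewrite -argE (r1 i').
Qed.

Definition endo_operad : operad k :=
  @Operad k end_sgmod end_id end_comp end_comp_linearl end_comp_linearr
    end_comp1l end_comp1r end_compA end_compAC end_comp_act.

End Endomorphisms.

Definition algebra (k : fieldType) (O : operad k) (A : lmodType k) : Type :=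
  operad_mor O (endo_operad A).

Definition binary (k : fieldType) (A : lmodType k) (f : endo_operad A 2%N) (x y : A)
  : A := mlin_fun f (fun i => if i == ord0 then x else y).

Record ideal (k : fieldType) (O : operad k) := Ideal {
  ideal_mem :> forall n, set (O n);
  ideal0 : forall n, ideal_mem (0 : O n);
  ideal_linear : forall n c (a b : O n),
    ideal_mem a -> ideal_mem b -> ideal_mem (c *: a + b);
  ideal_act : forall n (a : O n) s,
    ideal_mem a -> ideal_mem (sg_act a s);
  ideal_compl : forall m n p (e : (m + n = p.+1)%N) (i : 'I_m)
      (a : O m) (b : O n),
    ideal_mem a -> ideal_mem (op_comp e i a b);
  ideal_compr : forall m n p (e : (m + n = p.+1)%N) (i : 'I_m)
      (a : O m) (b : O n),
    ideal_mem b -> ideal_mem (op_comp e i a b) }.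

Arguments ideal_mem {k O} _ n _.

Section GeneratedIdeal.
Variables (k : fieldType) (O : operad k) (G : forall n, set (O n)).

Definition ideal_gen_mem n : set (O n) :=
  [set a | forall J : ideal O, (forall m, (G (n:=m) `<=` J m)%classic) -> J n a].

Program Definition ideal_gen : ideal O := @Ideal k O ideal_gen_mem _ _ _ _ _.
Next Obligation. by move=> n J _; apply: ideal0. Qed.
Next Obligation.
by move=> n c a b ha hb J GJ; apply: ideal_linear; [apply: ha|apply: hb].
Qed.
Next Obligation. by move=> n a s ha J GJ; apply/ideal_act/ha. Qed.
Next Obligation. by move=> *; move=> J GJ; apply: ideal_compl; auto. Qed.
Next Obligation. by move=> *; move=> J GJ; apply: ideal_compr; auto. Qed.

End GeneratedIdeal.

Section Quotient.
Variables (k : fieldType) (O : operad k) (I : ideal O).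

Lemma idealB n (a b : O n) : I n a -> I n b -> I n (a - b).
Proof. by move=> ha hb; rewrite -scaleN1r addrC; apply: ideal_linear. Qed.

Lemma idealN n (a : O n) : I n a -> I n (- a).
Proof. by move=> ha; rewrite -sub0r; apply: idealB => //; apply: ideal0. Qed.

Lemma idealD n (a b : O n) : I n a -> I n b -> I n (a + b).
Proof. by move=> ha hb; rewrite -[b]opprK; apply: idealB => //; apply: idealN. Qed.

Definition ideal_rel n : rel (O n) := fun a b => `[< I n (a - b) >].

Lemma ideal_rel_refl n : reflexive (@ideal_rel n).
Proof. by move=> a; apply/asboolP; rewrite subrr; apply: ideal0. Qed.

Lemma ideal_rel_sym n : symmetric (@ideal_rel n).
Proof.
by move=> a b; apply/asboolP/asboolP => /idealN; rewrite opprB.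
Qed.

Lemma ideal_rel_trans n : transitive (@ideal_rel n).
Proof.
move=> b a c /asboolP ab /asboolP bc; apply/asboolP.
by rewrite -[a](subrK b) -addrA; apply: idealD.
Qed.

Canonical ideal_equiv n :=
  EquivRel (@ideal_rel n) (@ideal_rel_refl n) (@ideal_rel_sym n)
    (@ideal_rel_trans n).

Definition qcar n : Type := {eq_quot (ideal_equiv n)}.
HB.instance Definition _ n := Choice.on (qcar n).

Definition qpi n (a : O n) : qcar n := \pi_{eq_quot (ideal_equiv n)} a.
Definition qrepr n (x : qcar n) : O n :=
  generic_quotient.repr (x : {eq_quot (ideal_equiv n)}).

Lemma qpiP n (a b : O n) : qpi a = qpi b <-> I n (a - b).
Proof.
by split=> [/eqmodP/asboolP//|h]; apply/eqmodP/asboolP.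
Qed.

Lemma qreprK n : cancel (@qrepr n) (@qpi n).
Proof. by move=> x; apply: reprK. Qed.

Lemma qpi_ind n (Q : qcar n -> Prop) : (forall a, Q (qpi a)) -> forall x, Q x.
Proof. by move=> h x; rewrite -[x]qreprK. Qed.

Lemma qrepr_pi n (a : O n) : I n (qrepr (qpi a) - a).
Proof. by apply/qpiP; rewrite qreprK. Qed.

Definition qlin n (c : k) (x y : qcar n) : qcar n :=
  qpi (c *: qrepr x + qrepr y).

Lemma qlinE n c (a b : O n) : qlin c (qpi a) (qpi b) = qpi (c *: a + b).
Proof.
apply/qpiP; rewrite opprD addrACA -scalerBr.
by apply: ideal_linear; apply: qrepr_pi.
Qed.

Definition qzero n : qcar n := qpi 0.
Definition qadd n (x y : qcar n) := qlin 1 x y.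
Definition qopp n (x : qcar n) := qlin (-1) x (qzero n).
Definition qscale n c (x : qcar n) := qlin c x (qzero n).

Let qaddE n (a b : O n) : qadd (qpi a) (qpi b) = qpi (a + b).
Proof. by rewrite /qadd qlinE scale1r. Qed.
Let qoppE n (a : O n) : qopp (qpi a) = qpi (- a).
Proof. by rewrite /qopp qlinE scaleN1r addr0. Qed.
Let qscaleE n c (a : O n) : qscale c (qpi a) = qpi (c *: a).
Proof. by rewrite /qscale qlinE addr0. Qed.

Lemma qaddA n : associative (@qadd n).
Proof.
by elim/qpi_ind=> a; elim/qpi_ind=> b; elim/qpi_ind=> c; rewrite !qaddE addrA.
Qed.
Lemma qaddC n : commutative (@qadd n).
Proof. by elim/qpi_ind=> a; elim/qpi_ind=> b; rewrite !qaddE addrC. Qed.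
Lemma qadd0 n : left_id (@qzero n) (@qadd n).
Proof. by elim/qpi_ind=> a; rewrite qaddE add0r. Qed.
Lemma qaddN n : left_inverse (@qzero n) (@qopp n) (@qadd n).
Proof. by elim/qpi_ind=> a; rewrite qoppE qaddE addNr. Qed.

HB.instance Definition _ n :=
  GRing.isZmodule.Build (qcar n) (@qaddA n) (@qaddC n) (@qadd0 n) (@qaddN n).

Lemma qscaleA n c d (x : qcar n) : qscale c (qscale d x) = qscale (c * d) x.
Proof. by elim/qpi_ind: x => a; rewrite !qscaleE scalerA. Qed.
Lemma qscale1 n : left_id 1 (@qscale n).
Proof. by elim/qpi_ind=> a; rewrite qscaleE scale1r. Qed.
Lemma qscaleDr n : right_distributive (@qscale n) +%R.
Proof.
move=> c; elim/qpi_ind=> a; elim/qpi_ind=> b.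
have D (x y : qcar n) : x + y = qadd x y by [].
by rewrite !D qaddE !qscaleE qaddE scalerDr.
Qed.
Lemma qscaleDl n (x : qcar n) : {morph (@qscale n)^~ x : c d / c + d}.
Proof.
move=> c d; elim/qpi_ind: x => a.
have D (x y : qcar n) : x + y = qadd x y by [].
by rewrite D !qscaleE qaddE scalerDl.
Qed.

HB.instance Definition _ n :=
  GRing.Zmodule_isLmodule.Build k (qcar n) (@qscaleA n) (@qscale1 n)
    (@qscaleDr n) (@qscaleDl n).

Lemma qpi_linear n : linear (@qpi n).
Proof.
move=> c a b; have D (x y : qcar n) : c *: x + y = qadd (qscale c x) y by [].
by rewrite D qscaleE qaddE.
Qed.

HB.instance Definition _ n :=
  GRing.isLinear.Build k (O n) (qcar n) *:%R (@qpi n) (@qpi_linear n).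

Definition qact n (x : qcar n) s : qcar n := qpi (sg_act (qrepr x) s).

Lemma qactE n (a : O n) s : qact (qpi a) s = qpi (sg_act a s).
Proof.
have B c d : sg_act (c - d) s = sg_act c s - sg_act d s :> O n.
  by rewrite addrC -scaleN1r sg_act_linear scaleN1r addrC.
by apply/qpiP; rewrite -B; apply/ideal_act/qrepr_pi.
Qed.

Definition qcomp m n p (e : (m + n = p.+1)%N) (i : 'I_m) (x : qcar m)
    (y : qcar n) : qcar p := qpi (op_comp e i (qrepr x) (qrepr y)).

Lemma qcompE m n p (e : (m + n = p.+1)%N) (i : 'I_m) (a : O m) (b : O n) :
  qcomp e i (qpi a) (qpi b) = qpi (op_comp e i a b).
Proof.
have Bl c d f : op_comp e i (c - d) f = op_comp e i c f - op_comp e i d f.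
  by rewrite addrC -scaleN1r op_comp_linearl scaleN1r addrC.
have Br c d f : op_comp e i f (c - d) = op_comp e i f c - op_comp e i f d.
  by rewrite addrC -scaleN1r op_comp_linearr scaleN1r addrC.
apply/qpiP; set a' := qrepr _; set b' := qrepr _.
rewrite -[op_comp _ _ a' _](subrK (op_comp e i a b')) -Bl -addrA -Br.
by apply: idealD; [apply: ideal_compl|apply: ideal_compr]; apply: qrepr_pi.
Qed.

Lemma qact_linear n s : linear (@qact n ^~ s).
Proof.
move=> c; elim/qpi_ind=> a; elim/qpi_ind=> b.
by rewrite -linearP !qactE sg_act_linear linearP.
Qed.

Lemma qact1 n (x : qcar n) : qact x 1%g = x.
Proof. by elim/qpi_ind: x => a; rewrite qactE sg_act1. Qed.

Lemma qactM n (x : qcar n) s t : qact x (s * t)%g = qact (qact x s) t.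
Proof. by elim/qpi_ind: x => a; rewrite !qactE sg_actM. Qed.

Definition quot_sgmod n : sgmod k n :=
  SgMod (@qact_linear n) (@qact1 n) (@qactM n).

Program Definition quot_operad : operad k :=
  @Operad k quot_sgmod (qpi (op_id O)) qcomp _ _ _ _ _ _ _.
Next Obligation.
move=> m n p e i y c; elim/qpi_ind=> a; elim/qpi_ind=> a'.
by elim/qpi_ind: y => b; rewrite -linearP !qcompE op_comp_linearl linearP.
Qed.
Next Obligation.
move=> m n p e i y c; elim/qpi_ind=> a; elim/qpi_ind=> a'.
by elim/qpi_ind: y => b; rewrite -linearP !qcompE op_comp_linearr linearP.
Qed.
Next Obligation.
by move=> n e i; elim/qpi_ind=> a; rewrite qcompE op_comp1l.
Qed.
Next Obligation.
by move=> n e i; elim/qpi_ind=> a; rewrite qcompE op_comp1r.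
Qed.
Next Obligation.
move=> l m n p q r e1 e2 e3 e4 i j h; elim/qpi_ind=> a; elim/qpi_ind=> b.
by elim/qpi_ind=> c hE; rewrite !qcompE (op_compA e1 e2 e3 e4 _ _ _ hE).
Qed.
Next Obligation.
move=> l m n p q r e1 e2 e3 e4 i j h h'; elim/qpi_ind=> a; elim/qpi_ind=> b.
by elim/qpi_ind=> c h1 h2 h3; rewrite !qcompE (op_compAC e1 e2 e3 e4 _ _ _ h1 h2 h3).
Qed.
Next Obligation.
move=> m n p e i s t r; elim/qpi_ind=> a; elim/qpi_ind=> b rP.
by rewrite /= (qactE a) (qactE b) !qcompE qactE (op_comp_act e _ _ rP).
Qed.

Program Definition quot_mor : operad_mor O quot_operad :=
  @OperadMor k O quot_operad (@SmodMor k O quot_operad (fun n => @qpi n) _) _ _.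
Next Obligation. by move=> n u s; rewrite /= qactE. Qed.
Next Obligation. by []. Qed.
Next Obligation. by move=> *; rewrite /= qcompE. Qed.

End Quotient.

(** The free operad on [M] consists of the formal operadic expressions in the
    elements of [M], two expressions being identified when they have the same
    value under every equivariant linear interpretation of [M] in an operad.
    Its universal property is [free_lift_gen] and [free_lift_unique]. *)

Section Free.
Variables (k : fieldType) (M : forall n, sgmod k n).

Inductive fexpr : nat -> Type :=
| fgen n : M n -> fexpr n
| fid : fexpr 1
| fcomp m n p : (m + n = p.+1)%N -> 'I_m -> fexpr m -> fexpr n -> fexpr p
| fact n : fexpr n -> 'S_n -> fexpr n
| fzero n : fexpr n
| flin n : k -> fexpr n -> fexpr n -> fexpr n.

HB.instance Definition _ n := gen_eqMixin (fexpr n).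
HB.instance Definition _ n := gen_choiceMixin (fexpr n).

Fixpoint feval (O : operad k) (f : smod_mor M O) n (t : fexpr n) : O n :=
  match t in fexpr n return O n with
  | fgen n u => f n u
  | fid => op_id O
  | fcomp m n p e i a b => op_comp e i (feval f a) (feval f b)
  | fact n a s => sg_act (feval f a) s
  | fzero n => 0
  | flin n c a b => c *: feval f a + feval f b
  end.

Definition frel n : rel (fexpr n) := fun a b =>
  `[< forall (O : operad k) (f : smod_mor M O), feval f a = feval f b >].

Lemma frel_refl n : reflexive (@frel n).
Proof. by move=> a; apply/asboolP. Qed.

Lemma frel_sym n : symmetric (@frel n).
Proof. by move=> a b; apply/asboolP/asboolP => h O f; rewrite h. Qed.

Lemma frel_trans n : transitive (@frel n).
Proof.
by move=> b a c /asboolP ab /asboolP bc; apply/asboolP => O f; rewrite ab.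
Qed.

Canonical free_equiv n :=
  EquivRel (@frel n) (@frel_refl n) (@frel_sym n) (@frel_trans n).

Definition fcar n : Type := {eq_quot (free_equiv n)}.
HB.instance Definition _ n := Choice.on (fcar n).

Definition fpi n (a : fexpr n) : fcar n := \pi_{eq_quot (free_equiv n)} a.
Definition frepr n (x : fcar n) : fexpr n :=
  generic_quotient.repr (x : {eq_quot (free_equiv n)}).

Definition fvalue (O : operad k) (f : smod_mor M O) n (x : fcar n) : O n :=
  feval f (frepr x).

Lemma fvalueE (O : operad k) (f : smod_mor M O) n (a : fexpr n) :
  fvalue f (fpi a) = feval f a.
Proof.
suff /asboolP h : frel (frepr (fpi a)) a by apply: h.
exact/eqmodP/reprK.
Qed.

Lemma fvalue_inj n (x y : fcar n) :
  (forall (O : operad k) (f : smod_mor M O), fvalue f x = fvalue f y) -> x = y.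
Proof.
move=> h; rewrite -[x]reprK -[y]reprK.
by apply/eqmodP/asboolP => O f; apply: h.
Qed.

Definition free_zero n : fcar n := fpi (fzero n).
Definition free_lin n c (x y : fcar n) : fcar n :=
  fpi (flin c (frepr x) (frepr y)).
Definition free_add n (x y : fcar n) := free_lin 1 x y.
Definition free_opp n (x : fcar n) := free_lin (-1) x (free_zero n).
Definition free_scale n c (x : fcar n) := free_lin c x (free_zero n).
Definition free_act n (x : fcar n) s : fcar n := fpi (fact (frepr x) s).
Definition free_comp m n p (e : (m + n = p.+1)%N) (i : 'I_m) (x : fcar m)
  (y : fcar n) : fcar p := fpi (fcomp e i (frepr x) (frepr y)).
Definition free_id : fcar 1 := fpi fid.

Section Values.
Variables (O : operad k) (f : smod_mor M O).

Lemma fvalue0 n : fvalue f (free_zero n) = 0.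
Proof. exact: fvalueE. Qed.
Lemma fvalue_lin n c (x y : fcar n) :
  fvalue f (free_lin c x y) = c *: fvalue f x + fvalue f y.
Proof. exact: fvalueE. Qed.
Lemma fvalue_add n (x y : fcar n) :
  fvalue f (free_add x y) = fvalue f x + fvalue f y.
Proof. by rewrite fvalue_lin scale1r. Qed.
Lemma fvalue_opp n (x : fcar n) : fvalue f (free_opp x) = - fvalue f x.
Proof. by rewrite fvalue_lin scaleN1r fvalue0 addr0. Qed.
Lemma fvalue_scale n c (x : fcar n) :
  fvalue f (free_scale c x) = c *: fvalue f x.
Proof. by rewrite fvalue_lin fvalue0 addr0. Qed.
Lemma fvalue_act n (x : fcar n) s :
  fvalue f (free_act x s) = sg_act (fvalue f x) s.
Proof. exact: fvalueE. Qed.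
Lemma fvalue_comp m n p (e : (m + n = p.+1)%N) (i : 'I_m) x y :
  fvalue f (free_comp e i x y) = op_comp e i (fvalue f x) (fvalue f y).
Proof. exact: fvalueE. Qed.
Lemma fvalue_id : fvalue f free_id = op_id O.
Proof. exact: fvalueE. Qed.

End Values.

Let fvalE := (fvalue_add, fvalue_opp, fvalue_scale, fvalue0, fvalue_act,
  fvalue_comp, fvalue_id).

Lemma free_addA n : associative (@free_add n).
Proof. by move=> x y z; apply: fvalue_inj => O f; rewrite !fvalE addrA. Qed.
Lemma free_addC n : commutative (@free_add n).
Proof. by move=> x y; apply: fvalue_inj => O f; rewrite !fvalE addrC. Qed.
Lemma free_add0 n : left_id (@free_zero n) (@free_add n).
Proof. by move=> x; apply: fvalue_inj => O f; rewrite !fvalE add0r. Qed.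
Lemma free_addN n : left_inverse (@free_zero n) (@free_opp n) (@free_add n).
Proof. by move=> x; apply: fvalue_inj => O f; rewrite !fvalE addNr. Qed.

HB.instance Definition _ n := GRing.isZmodule.Build (fcar n)
  (@free_addA n) (@free_addC n) (@free_add0 n) (@free_addN n).

Lemma fvalueD (O : operad k) (f : smod_mor M O) n (x y : fcar n) :
  fvalue f (x + y) = fvalue f x + fvalue f y.
Proof. exact: fvalue_add. Qed.

Lemma free_scaleA n c d (x : fcar n) :
  free_scale c (free_scale d x) = free_scale (c * d) x.
Proof. by apply: fvalue_inj => O f; rewrite !fvalE scalerA. Qed.
Lemma free_scale1 n : left_id 1 (@free_scale n).
Proof. by move=> x; apply: fvalue_inj => O f; rewrite !fvalE scale1r. Qed.
Lemma free_scaleDr n : right_distributive (@free_scale n) +%R.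
Proof.
by move=> c x y; apply: fvalue_inj => O f; rewrite !(fvalueD, fvalE) scalerDr.
Qed.
Lemma free_scaleDl n (x : fcar n) :
  {morph (@free_scale n)^~ x : c d / c + d}.
Proof.
by move=> c d; apply: fvalue_inj => O f; rewrite !(fvalueD, fvalE) scalerDl.
Qed.

HB.instance Definition _ n := GRing.Zmodule_isLmodule.Build k (fcar n)
  (@free_scaleA n) (@free_scale1 n) (@free_scaleDr n) (@free_scaleDl n).

Lemma fvalue_linear (O : operad k) (f : smod_mor M O) n :
  linear (@fvalue O f n).
Proof. by move=> c x y; rewrite fvalueD fvalue_scale. Qed.

HB.instance Definition _ (O : operad k) (f : smod_mor M O) n :=
  GRing.isLinear.Build k (fcar n) (O n) *:%R (@fvalue O f n)
    (@fvalue_linear O f n).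

Lemma free_act_linear n s : linear (@free_act n ^~ s).
Proof.
move=> c x y; apply: fvalue_inj => O f.
rewrite (fvalue_linear f) !fvalue_act (fvalue_linear f).
exact: sg_act_linear.
Qed.

Lemma free_act1 n (x : fcar n) : free_act x 1%g = x.
Proof. by apply: fvalue_inj => O f; rewrite fvalue_act sg_act1. Qed.

Lemma free_actM n (x : fcar n) s t :
  free_act x (s * t)%g = free_act (free_act x s) t.
Proof. by apply: fvalue_inj => O f; rewrite !fvalue_act sg_actM. Qed.

Definition free_sgmod n : sgmod k n :=
  SgMod (@free_act_linear n) (@free_act1 n) (@free_actM n).

Program Definition free_operad : operad k :=
  @Operad k free_sgmod free_id free_comp _ _ _ _ _ _ _.
Next Obligation.
move=> m n p e i y c x x'; apply: fvalue_inj => O f.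
rewrite (fvalue_linear f) !fvalue_comp (fvalue_linear f).
exact: (op_comp_linearl e i).
Qed.
Next Obligation.
move=> m n p e i y c x x'; apply: fvalue_inj => O f.
rewrite (fvalue_linear f) !fvalue_comp (fvalue_linear f).
exact: (op_comp_linearr e i).
Qed.
Next Obligation.
move=> n e i x; apply: fvalue_inj => O f.
by rewrite fvalue_comp fvalue_id op_comp1l.
Qed.
Next Obligation.
move=> n e i x; apply: fvalue_inj => O f.
by rewrite fvalue_comp fvalue_id op_comp1r.
Qed.
Next Obligation.
move=> l m n p q r e1 e2 e3 e4 i j h a b c hE; apply: fvalue_inj => O f.
by rewrite !fvalue_comp (op_compA e1 e2 e3 e4 _ _ _ hE).
Qed.
Next Obligation.
move=> l m n p q r e1 e2 e3 e4 i j h h' a b c h1 h2 h3.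
apply: fvalue_inj => O f.
by rewrite !fvalue_comp (op_compAC e1 e2 e3 e4 _ _ _ h1 h2 h3).
Qed.
Next Obligation.
move=> m n p e i s t r a b rP; apply: fvalue_inj => O f.
rewrite (fvalue_comp f e) (fvalue_act f a) (fvalue_act f b).
by rewrite (fvalue_act f (free_comp e i a b)) fvalue_comp (op_comp_act e _ _ rP).
Qed.

Definition free_gen_fun n (u : M n) : fcar n := fpi (fgen u).

Lemma free_gen_linear n : linear (@free_gen_fun n).
Proof.
move=> c u v; apply: fvalue_inj => O f.
rewrite (fvalue_linear f) !fvalueE; exact: linearP.
Qed.

HB.instance Definition _ n := GRing.isLinear.Build k (M n) (fcar n) *:%R
  (@free_gen_fun n) (@free_gen_linear n).

Program Definition free_gen : smod_mor M free_operad :=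
  @SmodMor k M free_operad (fun n => @free_gen_fun n) _.
Next Obligation.
move=> n u s; apply: fvalue_inj => O f.
by rewrite (fvalue_act f (free_gen_fun u)) !fvalueE /= smor_act.
Qed.

Program Definition free_lift (O : operad k) (f : smod_mor M O) :
  operad_mor free_operad O :=
  @OperadMor k free_operad O (@SmodMor k free_operad O (fun n => @fvalue O f n) _) _ _.
Next Obligation. by move=> O f n u s; apply: fvalue_act. Qed.
Next Obligation. by move=> O f; apply: fvalue_id. Qed.
Next Obligation. by move=> *; apply: fvalue_comp. Qed.

Lemma free_lift_gen (O : operad k) (f : smod_mor M O) n (u : M n) :
  free_lift f n (free_gen n u) = f n u.
Proof. exact: fvalueE. Qed.

Lemma free_lift_unique (O : operad k) (g h : operad_mor free_operad O) :
  (forall n (u : M n), g n (free_gen n u) = h n (free_gen n u)) ->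
  forall n (x : free_operad n), g n x = h n x.
Proof.
move=> gh.
suff H n (a : fexpr n) : g n (fpi a) = h n (fpi a).
  by move=> n x; rewrite -[x]reprK; apply: H.
elim: a => {n} [n u||m n p e i a IHa b IHb|n a IHa s|n|n c a IHa b IHb].
- exact: gh.
- by rewrite (omor_id g) (omor_id h).
- have -> : fpi (fcomp e i a b) = op_comp (o := free_operad) e i (fpi a) (fpi b).
    by apply: fvalue_inj => O' f; rewrite fvalue_comp !fvalueE.
  by rewrite (omor_comp g) (omor_comp h) IHa IHb.
- have -> : fpi (fact a s) = @sg_act k n (free_operad n) (fpi a) s.
    by apply: fvalue_inj => O' f; rewrite fvalue_act !fvalueE.
  by rewrite (smor_act g) (smor_act h) IHa.
- have -> : fpi (fzero n) = 0 :> free_operad n.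
    by [].
  by rewrite !linear0.
have -> : fpi (flin c a b) = c *: (fpi a : free_operad n) + (fpi b : free_operad n).
  apply: fvalue_inj => O' f; rewrite fvalueE.
  by rewrite (fvalue_linear f) !fvalueE.
by rewrite !linearP IHa IHb.
Qed.

End Free.

(** [T(M)/(G)] *)
Definition presented (k : fieldType) (M : forall n, sgmod k n)
    (G : forall n, set (free_operad M n)) : operad k :=
  quot_operad (ideal_gen G).

Definition presented_class (k : fieldType) (M : forall n, sgmod k n)
    (G : forall n, set (free_operad M n)) n (u : free_operad M n) : presented G n :=
  quot_mor (ideal_gen G) n u.

Inductive tree (D : Type) := Leaf of nat | Node of D & tree D & tree D.
Arguments Leaf {D} _.

HB.instance Definition _ (D : Type) := gen_eqMixin (tree D).

Section Trees.
Variable D : Type.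

Fixpoint leaves (t : tree D) : seq nat :=
  match t with Leaf x => [:: x] | Node _ l r => leaves l ++ leaves r end.

Fixpoint nleaves (t : tree D) : nat :=
  match t with Leaf _ => 1 | Node _ l r => (nleaves l + nleaves r)%N end.

Fixpoint decorated_in (B : set D) (t : tree D) : Prop :=
  match t with
  | Leaf _ => True
  | Node d l r => [/\ B d, decorated_in B l & decorated_in B r]
  end.

Fixpoint shape (t : tree D) : tree unit :=
  match t with Leaf x => Leaf x | Node _ l r => Node tt (shape l) (shape r) end.

Definition well_labelled (t : tree D) : bool :=
  uniq (leaves t) && (0%N \notin leaves t).

End Trees.

(** Isomorphism of leaf-labelled rooted trees, regardless of planar
    structure. *)
Inductive tree_iso : tree unit -> tree unit -> Prop :=
| iso_leaf x : tree_iso (Leaf x) (Leaf x)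
| iso_node l l' r r' : tree_iso l l' -> tree_iso r r' ->
    tree_iso (Node tt l r) (Node tt l' r')
| iso_swap l l' r r' : tree_iso l l' -> tree_iso r r' ->
    tree_iso (Node tt l r) (Node tt r' l').

Definition planar_representatives (T : set (tree unit)) : Prop :=
  forall t, well_labelled t -> exists! t', T t' /\ tree_iso t t'.

Section TreeValue.
Variables (k : fieldType) (O : operad k) (D : Type) (g : D -> O 2%N).

Fact node_arity_r n : (2 + n = n.+1.+1)%N.
Proof. by []. Qed.

Fact node_arity_l m n : (n.+1 + m = (m + n).+1)%N.
Proof. by rewrite addSn addnC. Qed.

Fixpoint planar_value (t : tree D) : O (nleaves t) :=
  match t return O (nleaves t) with
  | Leaf _ => op_id O
  | Node d l r =>
      op_comp (node_arity_l (nleaves l) (nleaves r)) ord0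
        (op_comp (node_arity_r (nleaves r)) ord_max (g d) (planar_value r))
        (planar_value l)
  end.

(** The order-preserving bijection from the set of leaf labels to the inputs
    identifies the label [x] with its rank; [label_perm t] sends the position
    of a leaf, read from left to right, to the rank of its label. *)
Definition label_rank (L : seq nat) (x : nat) : nat :=
  count (fun y => (y < x)%N) L.

Definition label_perm (t : tree D) : 'S_(nleaves t) :=
  odflt 1%g [pick s : 'S_(nleaves t) |
    [forall q, (s q : nat) == label_rank (leaves t) (nth 0%N (leaves t) q)]].

Definition tree_value (t : tree D) : O (nleaves t) :=
  sg_act (planar_value t) (label_perm t).

(** The value of a tree in a given arity, [0] if the tree does not have this
    number of leaves. *)
Definition tree_value_at (n : nat) (t : tree D) : O n :=
  match nleaves t =P n with
  | ReflectT e => ecast m (O m) e (tree_value t)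
  | ReflectF _ => 0
  end.

End TreeValue.

Definition lincomb (k : fieldType) (D : Type) : Type := seq (k * tree D).

Definition Lin (k : fieldType) (D : Type) (r : lincomb k D) : set nat :=
  [set x | exists2 p, p \in r & x \in leaves p.2].

Definition lincomb_value (k : fieldType) (O : operad k) (D : Type)
    (g : D -> O 2%N) (n : nat) (r : lincomb k D) : O n :=
  \sum_(p <- r) p.1 *: tree_value_at g n p.2.

Definition values (k : fieldType) (O : operad k) (D : Type) (g : D -> O 2%N)
    (R : set (lincomb k D)) (n : nat) : set (O n) :=
  [set a | exists2 r, R r &
     (forall p, p \in r -> nleaves p.2 = n) /\ a = lincomb_value g n r].

Arguments values {k O D} g R n _.

Definition is_basis (k : fieldType) (V : lmodType k) (B : set V) : Prop :=
  (forall (s : seq V) (c : V -> k), uniq s -> (forall v, v \in s -> B v) ->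
     \sum_(v <- s) c v *: v = 0 -> forall v, v \in s -> c v = 0) /\
  (forall u : V, exists (s : seq V) (c : V -> k),
     (forall v, v \in s -> B v) /\ u = \sum_(v <- s) c v *: v).

(** [r] is the expansion, in the tree basis given by the basis [B] of [V] and
    the planar representatives [T], of a locally homogeneous element. *)
Definition locally_homogeneous (k : fieldType) (V : lmodType k) (B : set V)
    (T : set (tree unit)) (r : lincomb k V) : Prop :=
  [/\ uniq [seq p.2 | p <- r],
      forall p, p \in r -> p.1 != 0,
      forall p, p \in r ->
        [/\ well_labelled p.2, decorated_in B p.2 & T (shape p.2)] &
      forall p q, p \in r -> q \in r -> leaves p.2 =i leaves q.2].

Section SModules.
Variable k : fieldType.

Program Definition zero_sgmod n : sgmod k n :=
  @SgMod k n 'rV[k]_0 (fun u _ => u) _ _ _.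
Next Obligation. by []. Qed.
Next Obligation. by []. Qed.
Next Obligation. by []. Qed.

Program Definition trivial_sgmod n : sgmod k n :=
  @SgMod k n k^o (fun u _ => u) _ _ _.
Next Obligation. by []. Qed.
Next Obligation. by []. Qed.
Next Obligation. by []. Qed.

Variable V : sgmod k 2.

Definition binary_smod (n : nat) : sgmod k n :=
  match n with 2 => V | n' => zero_sgmod n' end.

Definition binary_gen (v : V) : free_operad binary_smod 2%N :=
  free_gen binary_smod 2%N v.

Variable R : set (lincomb k V).

Definition binary_operad : operad k := presented (values binary_gen R).

Definition binary_class (v : V) : binary_operad 2%N :=
  presented_class (values binary_gen R) (binary_gen v).

End SModules.

Section Duplicator.
Variables (k : fieldType) (V : sgmod k 2).

(** The space [V (x) (k dashv (+) k vdash)] is represented by [V * V], the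
    first factor being [V (x) k dashv]. *)
Definition dashv (v : V) : V * V := (v, 0).
Definition vdash (v : V) : V * V := (0, v).

Definition Du_act (u : V * V) (s : 'S_2) : V * V :=
  if odd_perm s then (sg_act u.2 s, sg_act u.1 s)
  else (sg_act u.1 s, sg_act u.2 s).

Program Definition Du_sgmod : sgmod k 2 :=
  @SgMod k 2 (V * V)%type Du_act _ _ _.
Next Obligation.
by move=> s c [u1 u2] [v1 v2]; rewrite /Du_act /=; case: ifP => _;
  rewrite !sg_act_linear.
Qed.
Next Obligation.
by move=> [u1 u2]; rewrite /Du_act odd_perm1 /= !sg_act1.
Qed.
Next Obligation.
move=> [u1 u2] s t; rewrite /Du_act odd_permM.
by case: (odd_perm s); case: (odd_perm t); rewrite /= !sg_actM.
Qed.

(** [Du_tree x t w] means that [w] belongs to [Du_x(t)]: the path from the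
    root to [x] turns left at a vertex if [x] is a leaf of the left subtree
    of this vertex, right if it is a leaf of the right subtree. *)
Fixpoint Du_tree (x : nat) (t : tree V) (w : tree Du_sgmod) : Prop :=
  match t, w with
  | Leaf y, Leaf y' => y' = y
  | Node v l r, Node d l' r' =>
      [/\ if x \in leaves l then d = dashv v
          else if x \in leaves r then d = vdash v
          else d = dashv v \/ d = vdash v,
          Du_tree x l l' & Du_tree x r r']
  | _, _ => False
  end.

Definition Du_lincomb (x : nat) (r : lincomb k V) : set (lincomb k Du_sgmod) :=
  [set r' | List.Forall2 (fun p q => q.1 = p.1 /\ Du_tree x p.2 q.2) r r'].

Definition Du_relations (R : set (lincomb k V)) : set (lincomb k Du_sgmod) :=
  [set r' | exists2 r, R r & exists2 x, Lin r x & Du_lincomb x r r'].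

Definition duplicator (R : set (lincomb k V)) : operad k :=
  binary_operad (Du_relations R).

End Duplicator.

Definition di_average (k : fieldType) (A : lmodType k) (mul : A -> A -> A)
    (P : A -> A) : Prop :=
  forall x y, P (mul x (P y)) = mul (P x) (P y) /\
              mul (P x) (P y) = P (mul (P x) y).

Section DiAverage.
Variables (k : fieldType) (V : sgmod k 2).

Definition average_smod (n : nat) : sgmod k n :=
  match n with
  | 1 => trivial_sgmod k 1
  | 2 => V
  | n' => zero_sgmod k n'
  end.

Definition average_gen (v : V) : free_operad average_smod 2%N :=
  free_gen average_smod 2%N v.

Definition average_op : free_operad average_smod 1%N :=
  free_gen average_smod 1%N (1 : k^o).

(** [w o (id (x) u)], [w o (u (x) id)] and [u o w] for [u] unary and [w]
    binary *)
Definition comp_right (O : operad k) (w : O 2%N) (u : O 1%N) : O 2%N :=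
  op_comp (erefl : (2 + 1 = 3)%N) ord_max w u.
Definition comp_left (O : operad k) (w : O 2%N) (u : O 1%N) : O 2%N :=
  op_comp (erefl : (2 + 1 = 3)%N) ord0 w u.
Definition comp_out (O : operad k) (u : O 1%N) (w : O 2%N) : O 2%N :=
  op_comp (erefl : (1 + 2 = 3)%N) ord0 u w.

Definition average_relations (n : nat) : set (free_operad average_smod n) :=
  match n return set (free_operad average_smod n) with
  | 2 => [set a | exists v : V,
      let w := average_gen v in let P := average_op in
      a = comp_left (comp_right w P) P - comp_out P (comp_left w P) \/
      a = comp_left (comp_right w P) P - comp_out P (comp_right w P)]
  | _ => set0
  end.
Arguments average_relations n _ : clear implicits.

Variable R : set (lincomb k V).

Definition average_ideal_gen (n : nat) : set (free_operad average_smod n) :=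
  (values average_gen R n `|` average_relations n)%classic.

Definition average_operad : operad k := presented average_ideal_gen.

Definition average_class n (a : free_operad average_smod n) : average_operad n :=
  presented_class average_ideal_gen a.

End DiAverage.

(* Main.v *)
(** Both parts are instances of one statement about an operad [O] with binary
    operations [g v] and a unary operation [P] satisfying the di-average
    identities ([O = DA(P)] for (a), the endomorphism operad of [A] for (b)):
    if the elements of [R] vanish in [O], then the duplicator maps to [O].

    If [w] is a duplication of a decorated tree [t] along the leaf [x], then
    the value of [w] in [O] is the value of [t] with [P] inserted at every
    leaf except [x]: off the path to [x], the di-average identities move the
    [P] placed above a vertex to both of its branches, whichever of the two
    decorations was chosen.  As all trees of [r] in [R] have the same leaf
    labels, inserting [P] at all inputs but the one labelled [x] is the same
    linear operator on all of them, and it sends the value [0] of [r] to the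
    value of its duplication. *)
From HB Require Import structures.
Require Import Defs.
From mathcomp Require Import all_boot all_order all_algebra all_fingroup.
From mathcomp Require Import boolp classical_sets functions.

Set Implicit Arguments.
Unset Strict Implicit.
Unset Printing Implicit Defensive.

Import GRing.Theory.
Local Open Scope ring_scope.
Local Obligation Tactic := idtac.

(** * Binary grafting in an operad *)

Section OperadFacts.
Variables (k : fieldType) (O : operad k).

Lemma op_comp_eq m n p (e e' : (m + n = p.+1)%N) (i i' : 'I_m)
    (a : O m) (b : O n) :
  i = i' :> nat -> op_comp e i a b = op_comp e' i' a b.
Proof. by move=> /val_inj ->; rewrite (eq_irrelevance e e'). Qed.

Lemma op_comp0l m n p (e : (m + n = p.+1)%N) i (b : O n) :
  op_comp e i (0 : O m) b = 0.
Proof.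
by have := op_comp_linearl e i b (-1) 0 0; rewrite scaler0 addr0 scaleN1r addNr.
Qed.

Lemma op_comp0r m n p (e : (m + n = p.+1)%N) i (a : O m) :
  op_comp e i a (0 : O n) = 0.
Proof.
by have := op_comp_linearr e i a (-1) 0 0; rewrite scaler0 addr0 scaleN1r addNr.
Qed.

Lemma sg_act0 n s : sg_act (0 : O n) s = 0.
Proof.
by have := sg_act_linear s (-1) (0 : O n) 0; rewrite scaler0 addr0 scaleN1r addNr.
Qed.

(** The composite [G o (a (x) b)], in the form taken by the node case of [planar_value]. The right
    branch is grafted first, which leaves input 0 of [G] in place for [a]. *)
Definition node_comp (G : O 2%N) m n (a : O m) (b : O n) : O (m + n)%N :=
  op_comp (node_arity_l m n) ord0
    (op_comp (node_arity_r n) ord_max G b) a.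

Lemma ecast_node_comp (G : O 2%N) m m' n n' (em : m = m') (en : n = n')
    (e : (m + n = m' + n')%N) (a : O m) (b : O n) :
  ecast q (O q) e (node_comp G a b) =
  node_comp G (ecast q (O q) em a) (ecast q (O q) en b).
Proof. by case: m' / em e; case: n' / en => e; rewrite (eq_axiomK e). Qed.

Definition comp_outer (u : O 1%N) n (b : O n) : O n :=
  op_comp (erefl : (1 + n = n.+1)%N) ord0 u b.

Lemma node_comp_right G u m n (a : O m) (b : O n) :
  node_comp (comp_right G u) a b = node_comp G a (comp_outer u b).
Proof.
congr (op_comp _ _ _ a).
exact: (op_compA (erefl : 2 + 1 = 3)%N (node_arity_r n)).
Qed.

(** The operations [u] and [b] sit at different inputs of [G], so the parallel axiom exchanges them;
    [u] and [a] then merge by associativity. *)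
Lemma node_comp_left G u m n (a : O m) (b : O n) :
  node_comp (comp_left G u) a b = node_comp G (comp_outer u a) b.
Proof.
rewrite /node_comp /comp_left.
rewrite (op_compAC (erefl : 2 + 1 = 3)%N (node_arity_r n) (node_arity_r n)
  (addn1 n.+1 : (n.+1 + 1 = n.+2)%N) (j := ord_max) (h' := ord0)) //.
exact: op_compA.
Qed.

Lemma node_comp_out G u m n (a : O m) (b : O n) :
  node_comp (comp_out u G) a b = comp_outer u (node_comp G a b).
Proof.
rewrite /node_comp /comp_out /comp_outer.
rewrite (op_compA _ _ (node_arity_r n) (erefl : 1 + n.+1 = n.+2)%N
  (j := ord_max)) //.
exact: op_compA.
Qed.

End OperadFacts.

(** * Inserting a unary operation at chosen inputs *)

Section Plug.
Variables (k : fieldType) (O : operad k) (P : O 1%N).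

(** Composing with a unary operation preserves the arity, so the insertions
    at the various inputs are endomorphisms of [O n]; [pin q] is the identity
    if [q] is not an input. *)
Definition pin n (q : nat) (a : O n) : O n :=
  if insub q is Some i then op_comp (addn1 n : (n + 1 = n.+1)%N) i a P else a.

Definition plug n (s : seq nat) (a : O n) : O n :=
  foldr (@pin n) a s.

Lemma pinE n (i : 'I_n) (a : O n) : pin i a = op_comp (addn1 n) i a P.
Proof. by rewrite /pin valK. Qed.

Lemma pin_linear n q : linear (@pin n q).
Proof. by rewrite /pin; case: insubP => // i _ _; apply: op_comp_linearl. Qed.

Lemma plug_cons n q s (a : O n) : plug (q :: s) a = pin q (plug s a).
Proof. by []. Qed.

Lemma plug_linear n s : linear (@plug n s).
Proof. by elim: s => // q s IH c a b; rewrite !plug_cons IH pin_linear. Qed.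

Lemma plug0 n s : plug s (0 : O n) = 0.
Proof.
by have := plug_linear s (-1) (0 : O n) 0; rewrite scaler0 addr0 scaleN1r addNr.
Qed.

(** This is the parallel axiom: grafting a unary operation shifts no other input. *)
Lemma pinC n q q' (a : O n) : pin q (pin q' a) = pin q' (pin q a).
Proof.
wlog qq' : q q' / (q < q')%N.
  by move=> H; case: (ltngtP q q') => [/H//|/H//|->].
rewrite {1 4}/pin; case: insubP => [i _ iq|] //.
rewrite /pin; case: insubP => [i' _ iq'|] //.
apply/esym; apply: op_compAC; rewrite ?iq ?iq' //.
by rewrite /lpos ltnNge (ltnW qq') /= addn1.
Qed.

Lemma plug_pin n s q (a : O n) : plug s (pin q a) = pin q (plug s a).
Proof. by elim: s => // q' s IH; rewrite !plug_cons IH pinC. Qed.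

Lemma plug_cat n s s' (a : O n) : plug (s ++ s') a = plug s (plug s' a).
Proof. exact: foldr_cat. Qed.

Lemma plug_perm n s s' (a : O n) : perm_eq s s' -> plug s a = plug s' a.
Proof.
elim: s s' => [|q s IH] s' ss'.
  by move: ss'; rewrite perm_sym => /perm_nilP ->.
have qs' : q \in s' by rewrite -(perm_mem ss') mem_head.
case/path.splitPr: qs' ss' => s1 s2; rewrite perm_sym perm_catC /= perm_cons.
rewrite perm_catC perm_sym => /IH E.
by rewrite E !plug_cat plug_cons plug_pin.
Qed.

Lemma pin_act n (s : 'S_n) (i : 'I_n) (a : O n) :
  pin (s i) (sg_act a s) = sg_act (pin i a) s.
Proof.
(* With the identity acting on [P], the permutation induced on the composite is [s] itself, because
   [lpos 1] fixes all positions. *)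
rewrite !pinE -[P in LHS](sg_act1 P); apply: op_comp_act.
have lpos1 (j j' : nat) : j' != j -> lpos 1 j j' = j'.
  by rewrite /lpos => ?; rewrite addn1 if_same.
split=> [i' q ne|j q].
  rewrite !lpos1 ?(inj_eq val_inj) ?(inj_eq perm_inj) //.
  by move=> /val_inj ->.
by rewrite perm1 ord1 !addn0 => /val_inj ->.
Qed.

Lemma plug_act n (s : 'S_n) (S : seq 'I_n) (a : O n) :
  plug [seq val (s i) | i <- S] (sg_act a s) =
  sg_act (plug [seq val i | i <- S] a) s.
Proof. by elim: S => // i S IH; rewrite !map_cons !plug_cons IH pin_act. Qed.

Lemma pin_nodel (G : O 2%N) m n (a : O m) (b : O n) q : (q < m)%N ->
  pin q (node_comp G a b) = node_comp G (pin q a) b.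
Proof.
move=> qm; rewrite -[q in RHS]/(val (Ordinal qm)).
have qmn : (q < m + n)%N by apply: ltn_addr.
rewrite -[q]/(val (Ordinal qmn)) !pinE /node_comp.
exact: op_compA.
Qed.

Lemma pin_noder (G : O 2%N) m n (a : O m) (b : O n) q : (q < n)%N ->
  pin (m + q) (node_comp G a b) = node_comp G a (pin q b).
Proof.
move=> qn; rewrite -[q in RHS]/(val (Ordinal qn)).
have qmn : (m + q < m + n)%N by rewrite ltn_add2l.
rewrite -[(m + q)%N]/(val (Ordinal qmn)) !pinE /node_comp.
(* Input [m + q] of the node is input [q.+1] of the inner composite of [G] with [b], whose input 0
   still waits for [a]. *)
have q1 : (q.+1 < n.+1)%N by [].
rewrite (op_compAC _ _ (addn1 n.+1 : (n.+1 + 1 = n.+2)%N) (node_arity_l m n)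
  (j := Ordinal q1) (h' := ord0)) //; last by rewrite /lpos /= addnC.
congr (op_comp _ _ _ _).
exact: op_compA.
Qed.

Lemma plug_node (G : O 2%N) m n (a : O m) (b : O n) (s s' : seq nat) :
  all (ltn^~ m) s -> all (ltn^~ n) s' ->
  plug (s ++ [seq (m + q)%N | q <- s']) (node_comp G a b) =
  node_comp G (plug s a) (plug s' b).
Proof.
move=> sm s'n; rewrite plug_cat.
have -> : plug [seq (m + q)%N | q <- s'] (node_comp G a b) =
    node_comp G a (plug s' b).
  by elim: s' s'n => // q s' IH /andP[qn /IH E]; rewrite map_cons !plug_cons E pin_noder.
by elim: s sm => // q s IH /andP[qm /IH E]; rewrite !plug_cons E pin_nodel.
Qed.

End Plug.

(** * Ranks of leaf labels and values of trees *)

Section TreeValues.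
Variables (k : fieldType) (O : operad k) (D : Type) (g : D -> O 2%N).

Lemma label_rank_lt (L : seq nat) x y :
  (x < y)%N -> x \in L -> (label_rank L x < label_rank L y)%N.
Proof.
move=> xy xL; rewrite /label_rank.
(* The labels below [y] are those below [x] and those from [x] up to [y]; the latter include [x]. *)
have -> : count (fun z => (z < y)%N) L =
    (count (fun z => (z < x)%N) L + count (fun z => (x <= z < y)%N) L)%N.
  elim: (L) => //= z L' ->; rewrite addnACA; congr (_ + _)%N.
  by case: (ltnP z x) => //= zx; rewrite (ltn_trans zx xy).
rewrite -addn1 leq_add2l -has_count; apply/hasP.
by exists x; rewrite // leqnn.
Qed.

Lemma label_rank_lt_size (L : seq nat) x :
  x \in L -> (label_rank L x < size L)%N.
Proof.
move=> xL; rewrite ltn_neqAle count_size andbT -all_count.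
by apply/allPn; exists x; rewrite ?ltnn.
Qed.

Lemma nth_label_rank_inj (L : seq nat) i j :
  uniq L -> (i < size L)%N -> (j < size L)%N ->
  label_rank L (nth 0%N L i) = label_rank L (nth 0%N L j) -> i = j.
Proof.
move=> uL iL jL; wlog lt_ij : i j iL jL / (nth 0 L i < nth 0 L j)%N.
  move=> H E; case: (ltngtP (nth 0%N L i) (nth 0%N L j)) => [lt|lt|].
  - exact: H E.
  - exact/esym/H.
  - by move/eqP; rewrite nth_uniq // => /eqP.
by move/eqP; rewrite ltn_eqF // label_rank_lt // mem_nth.
Qed.

Lemma size_leaves (t : tree D) : size (leaves t) = nleaves t.
Proof. by elim: t => //= d l <- r <-; rewrite size_cat. Qed.

(** The default value in [label_perm] is never taken: for distinct labels the rank map is injective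
    on positions, hence a permutation. *)
Lemma label_permP (t : tree D) (q : 'I_(nleaves t)) :
  uniq (leaves t) ->
  label_perm t q = label_rank (leaves t) (nth 0%N (leaves t) q) :> nat.
Proof.
move=> ut; rewrite /label_perm; case: pickP => [s /forallP/(_ q)/eqP//|no].
have rank_lt (i : 'I_(nleaves t)) :
    (label_rank (leaves t) (nth 0%N (leaves t) i) < nleaves t)%N.
  rewrite -[X in (_ < X)%N]size_leaves label_rank_lt_size // mem_nth //.
  by rewrite size_leaves.
pose f i : 'I_(nleaves t) := Ordinal (rank_lt i).
have f_inj : injective f.
  move=> i j /(congr1 val) /= E; apply/val_inj.
  by apply: nth_label_rank_inj E; rewrite ?size_leaves.
case/forallP: (negbT (no (perm f_inj))) => i.
by rewrite permE.
Qed.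

(** The freedom in [e] and [s] allows a tree and its duplication, whose arities are only provably
    equal, to be evaluated with one permutation. *)
Lemma tree_value_atE n (t : tree D) (e : nleaves t = n) (s : 'S_n) :
  uniq (leaves t) ->
  (forall q : 'I_n, s q = label_rank (leaves t) (nth 0%N (leaves t) q) :> nat) ->
  tree_value_at g n t = sg_act (ecast m (O m) e (planar_value g t)) s.
Proof.
move=> ut; case: n / e s => s sE; rewrite /tree_value_at; case: eqP => // e.
rewrite (eq_axiomK e) /= /tree_value; congr (sg_act _ _).
by apply/permP => q; apply/val_inj; rewrite /= label_permP // sE.
Qed.

End TreeValues.

(** * Operad morphisms, kernels and quotients *)

Section Morphisms.
Variables (k : fieldType) (O O' : operad k) (h : operad_mor O O').

Lemma planar_value_mor (D : Type) (g : D -> O 2%N) (t : tree D) :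
  h _ (planar_value g t) = planar_value (fun d => h 2%N (g d)) t.
Proof.
elim: t => [x|d l IHl r IHr] /=; first exact: omor_id.
by rewrite !omor_comp IHl IHr.
Qed.

Lemma tree_value_at_mor (D : Type) (g : D -> O 2%N) n (t : tree D) :
  h n (tree_value_at g n t) = tree_value_at (fun d => h 2%N (g d)) n t.
Proof.
rewrite /tree_value_at; case: eqP => [e|_]; last exact: linear0.
by case: n / e => /=; rewrite /tree_value smor_act planar_value_mor.
Qed.

Lemma lincomb_value_mor (D : Type) (g : D -> O 2%N) n (r : lincomb k D) :
  h n (lincomb_value g n r) = lincomb_value (fun d => h 2%N (g d)) n r.
Proof.
rewrite /lincomb_value linear_sum; apply: eq_bigr => p _.
by rewrite linearZ_LR tree_value_at_mor.
Qed.

Program Definition kernel : ideal O :=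
  @Ideal k O (fun n => [set a | h n a = 0])%classic _ _ _ _ _.
Next Obligation. by move=> n; apply: linear0. Qed.
Next Obligation. by move=> n c a b /= ha hb; rewrite linearP ha hb scaler0 addr0. Qed.
Next Obligation. by move=> n a s /= ha; rewrite smor_act ha sg_act0. Qed.
Next Obligation. by move=> m n p e i a b /= ha; rewrite omor_comp ha op_comp0l. Qed.
Next Obligation. by move=> m n p e i a b /= hb; rewrite omor_comp hb op_comp0r. Qed.

Variable I : ideal O.
Hypothesis hI : forall n (a : O n), I n a -> h n a = 0.

Definition quot_lift_fun n (x : quot_operad I n) : O' n := h n (qrepr x).

(** The chosen representative does not matter: it differs from [a] by an element of [I], which [h]
    kills. *)
Lemma quot_lift_qpi n (a : O n) : quot_lift_fun (qpi I a) = h n a.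
Proof.
apply/eqP; rewrite -subr_eq0 /quot_lift_fun -linearB; apply/eqP/hI.
exact: qrepr_pi.
Qed.

Lemma quot_lift_linear n : linear (@quot_lift_fun n).
Proof.
move=> c; elim/qpi_ind=> a; elim/qpi_ind=> b.
by rewrite -linearP !quot_lift_qpi linearP.
Qed.

HB.instance Definition _ n := GRing.isLinear.Build k (quot_operad I n)
  (O' n) *:%R (@quot_lift_fun n) (@quot_lift_linear n).

Lemma quot_lift_act n (x : quot_operad I n) s :
  quot_lift_fun (sg_act x s) = sg_act (quot_lift_fun x) s.
Proof.
by elim/qpi_ind: x => a; rewrite /= Defs.qactE !quot_lift_qpi smor_act.
Qed.

Lemma quot_lift_comp m n p (e : (m + n = p.+1)%N) (i : 'I_m)
    (x : quot_operad I m) (y : quot_operad I n) :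
  quot_lift_fun (op_comp e i x y) =
  op_comp e i (quot_lift_fun x) (quot_lift_fun y).
Proof.
elim/qpi_ind: x => a; elim/qpi_ind: y => b.
by rewrite /= qcompE !quot_lift_qpi omor_comp.
Qed.

Lemma quot_lift_id : quot_lift_fun (op_id (quot_operad I)) = op_id O'.
Proof. by rewrite quot_lift_qpi omor_id. Qed.

Definition quot_lift : operad_mor (quot_operad I) O' :=
  @OperadMor k (quot_operad I) O'
    (@SmodMor k (quot_operad I) O' (fun n => @quot_lift_fun n) quot_lift_act)
    quot_lift_id quot_lift_comp.

End Morphisms.

(** * Morphisms out of presented operads *)

Lemma presented_lift (k : fieldType) (M : forall n, sgmod k n)
    (G : forall n, set (free_operad M n)) (O : operad k)
    (h : operad_mor (free_operad M) O) :
  (forall n a, G n a -> h n a = 0) ->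
  exists f : operad_mor (presented G) O,
    forall n a, f n (presented_class G a) = h n a.
Proof.
move=> hG.
have hI n a : ideal_gen G n a -> h n a = 0.
  (* The generated ideal lies in every ideal containing [G], in particular in the kernel of [h]. *)
  by move=> /(_ (kernel h)); apply=> m b; apply: hG.
by exists (quot_lift hI) => n a; apply: quot_lift_qpi.
Qed.

Lemma presented_class0 (k : fieldType) (M : forall n, sgmod k n)
    (G : forall n, set (free_operad M n)) n (a : free_operad M n) :
  G n a -> presented_class G a = 0.
Proof.
move=> Ga; rewrite /presented_class -(linear0 (quot_mor (ideal_gen G) n)).
by apply/qpiP; rewrite subr0 => J; apply.
Qed.

Section BinaryMorphism.
Variables (k : fieldType) (V : sgmod k 2) (O : operad k).
Variables (xi : {linear V -> O 2%N}).
Hypothesis xi_act : forall v s, xi (sg_act v s) = sg_act (xi v) s.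

Definition binary_mor_fun n : {linear binary_smod V n -> O n} :=
  match n return {linear binary_smod V n -> O n} with
  | 2 => xi
  | n' => \0
  end.

Lemma binary_mor_act n (u : binary_smod V n) s :
  binary_mor_fun n (sg_act u s) = sg_act (binary_mor_fun n u) s.
Proof. by case: n u s => [|[|[|n]]] u s /=; rewrite ?xi_act ?sg_act0. Qed.

Definition binary_mor : smod_mor (binary_smod V) O := SmodMor binary_mor_act.

End BinaryMorphism.

Lemma binary_operad_lift (k : fieldType) (V : sgmod k 2)
    (S : set (lincomb k V)) (O : operad k) (xi : {linear V -> O 2%N}) :
  (forall v s, xi (sg_act v s) = sg_act (xi v) s) ->
  (forall n a, values xi S n a -> a = 0) ->
  exists f : operad_mor (binary_operad S) O,
    forall v, f 2%N (binary_class S v) = xi v.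
Proof.
move=> xi_act xi0; pose h := free_lift (binary_mor xi_act).
have hgen v : h 2%N (binary_gen v) = xi v.
  exact: (free_lift_gen (binary_mor xi_act)).
have [|f fE] := presented_lift (h := h) (G := values (@binary_gen k V) S).
  (* Morphisms commute with the evaluation of trees, so [h] sends the value of [r] in the free
     operad to its value under [xi]. *)
  move=> n a [r Sr [rn ->]]; rewrite lincomb_value_mor (funext hgen).
  by apply: xi0; exists r.
by exists f => v; rewrite fE hgen.
Qed.

(** * Duplicated relations under the di-average identities *)

Section DuplicatorLift.
Variables (k : fieldType) (V : sgmod k 2) (O : operad k).
Variables (g : {linear V -> O 2%N}) (P : O 1%N).
Hypothesis g_act : forall v s, g (sg_act v s) = sg_act (g v) s.
Hypothesis averageL : forall v,
  comp_left (comp_right (g v) P) P = comp_out P (comp_left (g v) P).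
Hypothesis averageR : forall v,
  comp_left (comp_right (g v) P) P = comp_out P (comp_right (g v) P).

(** The linear extension of [\xi], a pair [u] being [dashv u.1 + vdash u.2]. *)
Definition Du_value (u : Du_sgmod V) : O 2%N :=
  comp_right (g u.1) P + comp_left (g u.2) P.

Lemma Du_value_linear : linear Du_value.
Proof.
move=> c u v; rewrite /Du_value /comp_right /comp_left !linearP.
by rewrite op_comp_linearl op_comp_linearl scalerDr addrACA.
Qed.

HB.instance Definition _ := GRing.isLinear.Build k (Du_sgmod V) (O 2%N) *:%R
  Du_value Du_value_linear.

Lemma Du_value_dashv v : Du_value (dashv v) = comp_right (g v) P.
Proof. by rewrite /Du_value /= linear0 /comp_left op_comp0l addr0. Qed.

Lemma Du_value_vdash v : Du_value (vdash v) = comp_left (g v) P.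
Proof. by rewrite /Du_value /= linear0 /comp_right op_comp0l add0r. Qed.

Lemma comp_leftE (G : O 2%N) : comp_left G P = pin P 0 G.
Proof. by rewrite -[0%N]/(val (ord0 : 'I_2)) pinE; apply: op_comp_eq. Qed.

Lemma comp_rightE (G : O 2%N) : comp_right G P = pin P 1 G.
Proof.
by rewrite -[1%N]/(val (ord_max : 'I_2)) pinE; apply: op_comp_eq.
Qed.

(** By [pin_act], renaming the inputs by [s] moves [P] from the input [i] to [s i]. The
    transposition thus exchanges the two summands, just as [Du_act] exchanges the two components. *)
Lemma Du_value_act (u : Du_sgmod V) s :
  Du_value (sg_act u s) = sg_act (Du_value u) s.
Proof.
have actD (a b : O 2%N) : sg_act (a + b) s = sg_act a s + sg_act b s.
  by have := sg_act_linear s 1 a b; rewrite !scale1r.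
have pinl (G : O 2%N) : sg_act (comp_left G P) s = pin P (s ord0) (sg_act G s).
  by rewrite pin_act comp_leftE.
have pinr (G : O 2%N) :
    sg_act (comp_right G P) s = pin P (s ord_max) (sg_act G s).
  by rewrite pin_act comp_rightE.
rewrite /Du_value actD pinl pinr -!g_act comp_leftE comp_rightE /= /Du_act.
have I2 (j : 'I_2) : j = ord0 \/ j = ord_max.
  by case: j => [[|[|//]] ?]; [left|right]; apply: val_inj.
have s_inj : s ord0 <> s ord_max by move/perm_inj/(congr1 val).
(* Injectivity leaves two of the four possible pairs of images: the identity and the
   transposition. *)
have [s0|s0] := I2 (s ord0); have [s1|s1] := I2 (s ord_max);
  rewrite s0 s1 in s_inj *; try by case: s_inj.
  have -> : s = 1%g by apply/permP => j; rewrite perm1; have [->|->] := I2 j.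
  by rewrite odd_perm1.
have -> : s = tperm ord0 ord_max.
  by apply/permP => j; have [->|->] := I2 j; rewrite ?tpermL ?tpermR.
by rewrite odd_tperm addrC.
Qed.

Lemma leaves_Du x (t : tree V) (w : tree (Du_sgmod V)) :
  Du_tree x t w -> leaves w = leaves t.
Proof.
by elim: t w => [y|v l IHl r IHr] [y'|d l' r'] //= => [->|[_ /IHl -> /IHr ->]].
Qed.

Lemma nleaves_Du x (t : tree V) (w : tree (Du_sgmod V)) :
  Du_tree x t w -> nleaves w = nleaves t.
Proof. by rewrite -!size_leaves => /leaves_Du ->. Qed.

(** If [x] is not a leaf of [t], an exterior [P] makes the statement inductive:
    it is what the vertex below [t] contributes. *)
Lemma planar_value_Du x (t : tree V) (w : tree (Du_sgmod V))
    (e : nleaves w = nleaves t) :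
  uniq (leaves t) -> Du_tree x t w ->
  (if x \in leaves t then id else @comp_outer _ _ P _)
    (ecast n (O n) e (planar_value Du_value w)) =
  plug P [seq q <- iota 0 (nleaves t) | nth 0%N (leaves t) q != x]
      (planar_value g t).
Proof.
elim: t w e => [y|v l IHl r IHr] [y'|d l' r'] //= e.
  move=> _ _; rewrite (eq_axiomK e) /=.
  rewrite inE eq_sym; case: eqP => //= _.
  rewrite -[0%N]/(val (ord0 : 'I_1)) pinE /comp_outer op_comp1l.
  exact: op_comp1r.
rewrite cat_uniq => /and3P[ul dis ur] [dE wl wr].
have el := nleaves_Du wl; have er := nleaves_Du wr.
have Pl := IHl _ el ul wl; have Pr := IHr _ er ur wr.
rewrite -!/(node_comp _ _ _) (ecast_node_comp _ el er).
(* The positions other than that of [x] split into those in [l] and those in [r], the latter shifted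
   by [nleaves l]. *)
have -> : [seq q <- iota 0 (nleaves l + nleaves r)
            | nth 0%N (leaves l ++ leaves r) q != x] =
    [seq q <- iota 0 (nleaves l) | nth 0%N (leaves l) q != x] ++
    [seq (nleaves l + q)%N |
       q <- [seq q <- iota 0 (nleaves r) | nth 0%N (leaves r) q != x]].
  rewrite iotaD filter_cat add0n -[X in iota X (nleaves r)]addn0 iotaDl.
  rewrite filter_map; congr cat; last congr map; apply: eq_in_filter => q.
    by rewrite mem_iota add0n => /andP[_ ql]; rewrite nth_cat size_leaves ql.
  by move=> _ /=; rewrite nth_cat size_leaves ltnNge leq_addr /= addKn.
rewrite plug_node; last 2 first.
- by apply/allP => q; rewrite mem_filter mem_iota => /and3P[].
- by apply/allP => q; rewrite mem_filter mem_iota => /and3P[].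
rewrite -Pl -Pr mem_cat.
(* When the path to [x] passes here, the forced decoration puts [P] on the branch without [x], which
   is the exterior [P] in the induction hypothesis for that branch. *)
case: (boolP (x \in leaves l)) dE => [xl ->|xl] /=.
  have -> : x \in leaves r = false.
    by apply: contraNF dis => xr; apply/hasP; exists x.
  by rewrite Du_value_dashv node_comp_right.
case: (boolP (x \in leaves r)) => [xr ->|xr] /=.
  by rewrite Du_value_vdash node_comp_left.
(* Off the path both branches carry an exterior [P]. The di-average identities turn [G o (P (x) P)]
   into [P] above either decorated vertex. *)
have -> G m n (a : O m) (b : O n) : node_comp G (comp_outer P a) (comp_outer P b) =
    node_comp (comp_left (comp_right G P) P) a b.
  by rewrite node_comp_left node_comp_right.
rewrite -node_comp_out.
by case=> ->; rewrite ?Du_value_dashv ?Du_value_vdash -?averageL -?averageR.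
Qed.

Definition other_ranks n (c : nat) : seq nat := [seq q <- iota 0 n | q != c].

(** This carries [planar_value_Du] from positions to ranks: [label_perm] sends the position of [x]
    to its rank, and by equivariance the insertions move along, up to their order. *)
Lemma tree_value_Du n x (t : tree V) (w : tree (Du_sgmod V)) :
  uniq (leaves t) -> x \in leaves t -> nleaves t = n -> Du_tree x t w ->
  tree_value_at Du_value n w =
  plug P (other_ranks n (label_rank (leaves t) x)) (tree_value_at g n t).
Proof.
move=> ut xt <- {n} tw; have lw := leaves_Du tw; have e := nleaves_Du tw.
have := planar_value_Du e ut tw; rewrite xt => Pw.
pose s := label_perm t; have sE q := label_permP q ut.
rewrite (tree_value_atE _ erefl ut sE).
(* The trees [w] and [t] have the same leaf sequence, so [s] serves for both. *)
rewrite (tree_value_atE _ e (s := s)) ?lw // [ecast _ _ _ _]Pw.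
have [i xi] : exists i : 'I_(nleaves t), nth 0%N (leaves t) i = x.
  have xlt : (index x (leaves t) < nleaves t)%N by rewrite -size_leaves index_mem.
  by exists (Ordinal xlt); rewrite /= nth_index.
have nthE (j : 'I_(nleaves t)) : (nth 0%N (leaves t) j == x) = (j == i).
  by rewrite -xi nth_uniq // size_leaves.
have -> : [seq q <- iota 0 (nleaves t) | nth 0%N (leaves t) q != x] =
    [seq val j | j <- [seq j <- enum 'I_(nleaves t) | j != i]].
  rewrite -val_enum_ord filter_map; congr map.
  by apply: eq_filter => j /=; rewrite nthE.
rewrite -plug_act; apply: plug_perm; apply: uniq_perm.
- rewrite map_inj_uniq; first exact/filter_uniq/enum_uniq.
  by move=> j j' /val_inj/perm_inj.
- by rewrite filter_uniq // iota_uniq.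
move=> q; rewrite mem_filter mem_iota add0n /=; apply/mapP/andP.
  move=> [j]; rewrite mem_filter => /andP[ji _] ->; split=> //.
  by rewrite -xi -sE (inj_eq val_inj) (inj_eq perm_inj).
move=> [qx qt]; pose j := (s^-1)%g (Ordinal qt); exists j.
  rewrite mem_filter mem_enum andbT; apply: contraNneq qx => ji.
  by rewrite -xi -sE -ji permKV.
by rewrite permKV.
Qed.

(** As the rank [c] of [x] is common to all terms, one linear operator [plug] comes out of the
    sum. *)
Lemma Du_lincomb_value n x (r : lincomb k V) (r' : lincomb k (Du_sgmod V))
    (c : nat) :
  (forall p, p \in r -> [/\ uniq (leaves p.2), x \in leaves p.2,
     nleaves p.2 = n & label_rank (leaves p.2) x = c]) ->
  Du_lincomb x r r' ->
  lincomb_value Du_value n r' = plug P (other_ranks n c) (lincomb_value g n r).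
Proof.
rewrite /lincomb_value => rP rr'; elim: rr' rP => [|p q s s' [pq pqDu] _ IH] rP.
  by rewrite !big_nil plug0.
rewrite !big_cons plug_linear IH => [|p' p's]; last first.
  by apply: rP; rewrite inE p's orbT.
have [up xp np rp] := rP p (mem_head _ _).
by rewrite pq (tree_value_Du up xp np pqDu) rp.
Qed.

Lemma Du_values (R : set (lincomb k V)) n a :
  (forall r, R r -> exists B T, locally_homogeneous B T r) ->
  (forall n a, values g R n a -> a = 0) ->
  values Du_value (Du_relations R) n a -> a = 0.
Proof.
move=> hR R0 [r' [r Rr [x [p0 p0r xp0] rr']] [r'n ->]].
have [B [T [_ _ labelled same]]] := hR r Rr.
have uniq_leaves p : p \in r -> uniq (leaves p.2).
  by case/labelled => /andP[].
have leaves_perm p : p \in r -> perm_eq (leaves p.2) (leaves p0.2).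
  by move=> pr; apply: uniq_perm; rewrite ?uniq_leaves //; apply: same.
have nE : nleaves p0.2 = n.
  (* The arity [n] is given through the trees of [r']; the one matching [p0] has as many leaves as
     [p0.2]. *)
  have [q qr' <-] : exists2 q, q \in r' & nleaves q.2 = nleaves p0.2.
    elim: rr' p0r {r'n Rr same labelled uniq_leaves leaves_perm} => //.
    move=> p q s s' [_ pq] _ IH; rewrite inE => /orP[/eqP ->|/IH[q' q's' <-]].
      exists q; first exact: mem_head.
      exact: nleaves_Du pq.
    by exists q'; rewrite // inE q's' orbT.
  exact: r'n.
rewrite (Du_lincomb_value (n := n) (c := label_rank (leaves p0.2) x) _ rr').
  rewrite (R0 n (lincomb_value g n r)).
    exact: plug0.
  exists r => //; split=> // p /leaves_perm/perm_size.
  by rewrite !size_leaves nE.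
move=> p pr; have pp0 := leaves_perm p pr; split.
- exact: uniq_leaves.
- by rewrite (perm_mem pp0).
- by rewrite -size_leaves (perm_size pp0) size_leaves.
(* A rank is a count over the labels, hence invariant under their permutation. *)
- by have /seq.permP := pp0; apply.
Qed.

Lemma duplicator_lift (R : set (lincomb k V)) :
  (forall r, R r -> exists B T, locally_homogeneous B T r) ->
  (forall n a, values g R n a -> a = 0) ->
  exists f : operad_mor (duplicator R) O, forall v,
    f 2%N (binary_class (Du_relations R) (dashv v)) = comp_right (g v) P /\
    f 2%N (binary_class (Du_relations R) (vdash v)) = comp_left (g v) P.
Proof.
move=> hR R0.
have [f fE] := binary_operad_lift Du_value_act
  (fun n a => @Du_values R n a hR R0).
exists f => v; rewrite !fE; split; first exact: Du_value_dashv.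
exact: Du_value_vdash.
Qed.

End DuplicatorLift.

(** * Unary and binary operations in the endomorphism operad *)

Section EndoUnary.
Variables (k : fieldType) (A : lmodType k) (P : {linear A -> A}).

Lemma endo_unary_multilinear : multilinear (fun x : 'I_1 -> A => P (x ord0)).
Proof. by move=> x i c u v; rewrite /upd !ord1 eqxx linearP. Qed.

Definition endo_unary : endo_operad A 1%N := mk_mlin endo_unary_multilinear.

Lemma binary_inj (f f' : endo_operad A 2%N) :
  (forall x y, binary f x y = binary f' x y) -> f = f'.
Proof.
move=> ff'; apply: mlin_eq => x.
have -> : x = fun i => if i == ord0 then x ord0 else x ord_max.
  apply/funext => i; case: eqP => [->//|/eqP i0]; congr x.
  by case: i i0 => [[|[|//]] ?] // _; apply: val_inj.
exact: ff'.
Qed.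

Lemma arg_pair (x y : A) q : (q < 2)%N ->
  arg (fun i : 'I_2 => if i == ord0 then x else y) q = if q == 0%N then x else y.
Proof. exact: (argF (fun q => if q == 0%N then x else y)). Qed.

Lemma binary_comp_right (f : endo_operad A 2%N) x y :
  binary (comp_right f endo_unary) x y = binary f x (P y).
Proof.
rewrite /binary /= /end_comp_fun /=; congr (f _); apply/funext => i.
by case: i => [[|[|//]] ?] /=; rewrite !arg_pair.
Qed.

Lemma binary_comp_left (f : endo_operad A 2%N) x y :
  binary (comp_left f endo_unary) x y = binary f (P x) y.
Proof.
rewrite /binary /= /end_comp_fun /=; congr (f _); apply/funext => i.
by case: i => [[|[|//]] ?] /=; rewrite !arg_pair.
Qed.

Lemma binary_comp_out (f : endo_operad A 2%N) x y :
  binary (comp_out endo_unary f) x y = P (binary f x y).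
Proof.
rewrite /binary /= /end_comp_fun /=; congr (P (f _)); apply/funext => i.
by case: i => [[|[|//]] ?] /=; rewrite !arg_pair.
Qed.

End EndoUnary.

(** * The morphism to the di-average operad and the induced algebras *)

Theorem theorem4p3 (k : fieldType) (V : sgmod k 2) (B : set V)
    (T : set (tree unit)) (R : set (lincomb k V))
    (hB : is_basis B) (hT : planar_representatives T)
    (hR : forall r, R r -> locally_homogeneous B T r) :
  (exists f : operad_mor (duplicator R) (average_operad R),
     forall w : V,
       f 2%N (binary_class (Du_relations R) (dashv w)) =
         average_class R (comp_right (average_gen w) (average_op V)) /\
       f 2%N (binary_class (Du_relations R) (vdash w)) =
         average_class R (comp_left (average_gen w) (average_op V))) /\
  (forall (A : lmodType k) (alpha : algebra (binary_operad R) A)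
      (P : {linear A -> A}),
     (forall w : V, di_average (binary (alpha 2%N (binary_class R w))) P) ->
     exists beta : algebra (duplicator R) A,
       forall (w : V) (x y : A),
         binary (beta 2%N (binary_class (Du_relations R) (dashv w))) x y =
           binary (alpha 2%N (binary_class R w)) x (P y) /\
         binary (beta 2%N (binary_class (Du_relations R) (vdash w))) x y =
           binary (alpha 2%N (binary_class R w)) (P x) y).
Proof.
have hR' r : R r -> exists B T, locally_homogeneous B T r.
  by move=> /hR; exists B, T.
split.
  (* Part (a): in [average_operad R] the classes of the generators satisfy the di-average identities
     and [R] by construction. *)
  pose q := quot_mor (ideal_gen (average_ideal_gen R)).
  pose g : {linear V -> average_operad R 2%N} :=
    q 2%N \o free_gen (average_smod V) 2%N.
  pose P : average_operad R 1%N := q 1%N (average_op V).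
  have qB (a b : free_operad (average_smod V) 2%N) :
      @average_relations k V 2 (a - b) -> q 2%N a = q 2%N b.
    move=> ab; apply/eqP; rewrite -subr_eq0 -linearB; apply/eqP.
    by apply: presented_class0; right.
  have rightE w :
      comp_right (g w) P = q 2%N (comp_right (average_gen w) (average_op V)).
    by rewrite /comp_right omor_comp.
  have leftE w :
      comp_left (g w) P = q 2%N (comp_left (average_gen w) (average_op V)).
    by rewrite /comp_left omor_comp.
  case: (@duplicator_lift k V _ g P _ _ _ R hR')
    => [v s|v|v|n a [r Rr [rn ->]]|f fE].
  - have gen_act := @smor_act k _ _ (free_gen (average_smod V)) 2 v s.
    exact: etrans (congr1 (q 2%N) gen_act) (smor_act q _ s).
  - rewrite rightE leftE /comp_left /comp_out -!omor_comp; apply: qB.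
    by exists v; left.
  - rewrite rightE /comp_left /comp_out -!omor_comp; apply: qB.
    by exists v; right.
  - rewrite -[LHS](lincomb_value_mor q (@average_gen k V)).
    by apply: presented_class0; left; exists r.
  by exists f => w; have [-> ->] := fE w; rewrite rightE leftE.
move=> A alpha P Pavg.
(* Part (b): the operad is now that of endomorphisms of [A], with [g] the action of [V] through
   [alpha]. *)
pose q := quot_mor (ideal_gen (values (@binary_gen k V) R)).
pose g : {linear V -> endo_operad A 2%N} :=
  alpha 2%N \o (q 2%N \o free_gen (binary_smod V) 2%N).
case: (@duplicator_lift k V _ g (endo_unary P) _ _ _ R hR')
  => [v s|v|v|n a [r Rr [rn ->]]|f fE].
- have gen_act := @smor_act k _ _ (free_gen (binary_smod V)) 2 v s.
  have q_act := etrans (congr1 (q 2%N) gen_act) (smor_act q _ s).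
  exact: etrans (congr1 (alpha 2%N) q_act) (smor_act alpha _ s).
- apply: binary_inj => x y.
  rewrite binary_comp_out !binary_comp_left binary_comp_right.
  by have [_ ->] := Pavg v x y.
- apply: binary_inj => x y.
  rewrite binary_comp_out !binary_comp_left !binary_comp_right.
  by have [-> _] := Pavg v x y.
(* The value of [r] on [A] is the image under [alpha] of its value in [binary_operad R], which is
   zero. *)
- rewrite -[LHS](lincomb_value_mor alpha (binary_class R)).
  rewrite -(lincomb_value_mor q (@binary_gen k V)).
  rewrite -[RHS](linear0 (alpha n)); congr (alpha n _).
  by apply: presented_class0; exists r.
exists f => w x y; have [-> ->] := fE w.
by rewrite binary_comp_left binary_comp_right.
Qed.
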